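(* Every weakly negative definite plumbed $3$-manifold is negative definite. Equivalently, for every weakly negative definite plumbing tree $\Gamma$ there exist a negative definite plumbing tree $\Gamma'$ and a finite sequence of plumbing trees $\Gamma = \Gamma_0, \Gamma_1, \dots, \Gamma_N = \Gamma'$ such that for each $0 \le i < N$ the trees $\Gamma_i$ and $\Gamma_{i+1}$ are related by a single Neumann move (of type $(A\pm)$, $(B\pm)$ or $(C)$, performed in either direction).
   Context: A plumbing tree $\Gamma$ is a finite (nonempty) tree with vertices $v_1,\dots,v_s$ in which each vertex $v_i$ carries an integer weight $m_i \in \mathbb{Z}$ (its Euler number). Its framing matrix is the symmetric $s\times s$ matrix $B=(B_{ij})$ with $B_{ii}=m_i$, with $B_{ij}=1$ if $i\ne j$ and $\{v_i,v_j\}$ is an edge of $\Gamma$, and $B_{ij}=0$ otherwise. The tree $\Gamma$ is negative definite if all eigenvalues of $B$ are strictly negative. The tree $\Gamma$ is weakly negative definite if $B$ is invertible over $\mathbb{Q}$ and the restriction of $B^{-1}$ (as a bilinear form) to the subspace of $\mathbb{Q}^s$ spanned by the standard basis vectors of the vertices of degree at least $3$ is negative definite; equivalently, the principal submatrix of $B^{-1}$ indexed by the vertices of degree at least $3$ is negative definite. If there are no vertices of degree at least $3$, this last condition is vacuous. Neumann moves are the following local modifications of plumbing trees, where $\epsilon\in\{+1,-1\}$ (the move with sign $\epsilon=\pm1$ is written $(A\pm)$, $(B\pm)$); all weights and edges not mentioned are unchanged. Each move relates a ''bottom'' tree and a ''top'' tree and may be used in both directions. $(A\epsilon)$: Bottom: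 an edge joining two vertices of weights $m_1$ and $m_2$. Top: this edge is replaced by a path of two edges through a new vertex of degree $2$ and weight $\epsilon$, and the weights of the two original vertices become $m_1+\epsilon$ and $m_2+\epsilon$. $(B\epsilon)$: Bottom: a vertex of weight $m_1$. Top: a new vertex of degree $1$ and weight $\epsilon$ is attached by an edge to this vertex, whose weight becomes $m_1+\epsilon$. $(C)$: Top: a vertex of weight $0$ and degree $2$ whose two neighbours have weights $m_1$ and $m_2$. Bottom: the weight-$0$ vertex and its two neighbours are replaced by a single vertex of weight $m_1+m_2$, adjacent to all the other neighbours of the two former vertices. The plumbed $3$-manifold associated to a plumbing tree $\Gamma$ is the closed oriented $3$-manifold obtained by plumbing oriented circle bundles over $S^2$ with Euler numbers $m_i$ according to the edges of $\Gamma$ (equivalently, by surgery on $S^3$ along the link of unknots, one per vertex, with framings $m_i$, two of which are simply linked exactly when the corresponding vertices are adjacent). Trees related by Neumann moves have homeomorphic plumbed $3$-manifolds. A plumbed $3$-manifold is called weakly negative definite (respectively negative definite) if it is the plumbed $3$-manifold of some weakly negative definite (respectively negative definite) plumbing tree. *)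

(* Defs.v *)
From HB Require Import structures.
From mathcomp Require Import all_boot all_order all_algebra all_field.

Set Implicit Arguments.
Unset Strict Implicit.
Unset Printing Implicit Defensive.

Import Order.TTheory GRing.Theory Num.Theory.
Local Open Scope ring_scope.

(* In [pt_acyclic] the size bound is 2, not 0: for an edge x y the sequence
   [:: x; y] is a [ucycle] that runs along the edge and back. *)
Record plumbing_tree := PlumbingTree {
  nvert : nat;
  adj : rel 'I_nvert;
  weight : 'I_nvert -> int;
  pt_nonempty : (0 < nvert)%N;
  pt_sym : symmetric adj;
  pt_irr : irreflexive adj;
  pt_connected : forall x y : 'I_nvert, connect adj x y;
  pt_acyclic : forall c : seq 'I_nvert, ucycle adj c -> (size c <= 2)%N
}.

Notation vertex G := 'I_(nvert G).

Definition degree (G : plumbing_tree) (v : vertex G) : nat :=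
  #|[set x | adj v x]|.

Definition framing_mx (G : plumbing_tree) : 'M[int]_(nvert G) :=
  \matrix_(i, j) (if i == j then weight i else (adj i j)%:R).

(* On [algC], a < 0 asserts that a is real and strictly negative. *)
Definition negative_definite (G : plumbing_tree) : Prop :=
  forall a : algC,
    eigenvalue (map_mx intr (framing_mx G) : 'M[algC]_(nvert G)) a -> a < 0.

Definition framing_mxQ (G : plumbing_tree) : 'M[rat]_(nvert G) :=
  map_mx intr (framing_mx G).

Definition branch_space (G : plumbing_tree) : 'M[rat]_(nvert G) :=
  (\sum_(v : vertex G | (3 <= degree v)%N) <<delta_mx 0 v : 'rV[rat]_(nvert G)>>)%MS.

Definition negative_definite_on (n : nat) (A V : 'M[rat]_n) : Prop :=
  forall x : 'rV[rat]_n, (x <= V)%MS -> x != 0 -> (x *m A *m x^T) 0 0 < 0.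

Definition weakly_negative_definite (G : plumbing_tree) : Prop :=
  framing_mxQ G \in unitmx /\
  negative_definite_on (invmx (framing_mxQ G)) (branch_space G).

(* The vertices of the top tree are w together with a copy, under f, of the
   vertices of the bottom tree; f also accounts for relabelling, so that moves
   are considered up to isomorphism of weighted trees. *)
Definition adds_vertex (bot top : plumbing_tree)
    (f : vertex bot -> vertex top) (w : vertex top) : Prop :=
  injective f /\ (forall y : vertex top, y != w <-> exists x, y = f x).

Definition moveA (eps : int) (bot top : plumbing_tree) : Prop :=
  exists (f : vertex bot -> vertex top) (w : vertex top) (u v : vertex bot),
    [/\ adds_vertex f w, adj u v,
        (forall x y, adj (f x) (f y) =
          adj x y && ~~ ((x == u) && (y == v) || (x == v) && (y == u))),
        (forall x, adj w (f x) = (x == u) || (x == v)) &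
        weight w = eps /\
        (forall x, weight (f x) =
          if (x == u) || (x == v) then weight x + eps else weight x)].

Definition moveB (eps : int) (bot top : plumbing_tree) : Prop :=
  exists (f : vertex bot -> vertex top) (w : vertex top) (u : vertex bot),
    [/\ adds_vertex f w,
        (forall x y, adj (f x) (f y) = adj x y),
        (forall x, adj w (f x) = (x == u)) &
        weight w = eps /\
        (forall x, weight (f x) =
          if x == u then weight x + eps else weight x)].

(* f contracts the path a - w - b of the top tree to the vertex c of the
   bottom tree and is a bijection between the remaining vertices. *)
Definition moveC (bot top : plumbing_tree) : Prop :=
  exists (f : vertex top -> vertex bot) (w a b : vertex top) (c : vertex bot),
    let old := [pred x | x \notin [:: w; a; b]] in
    [/\ [/\ weight w = 0, degree w = 2%N, adj w a, adj w b & a != b],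
        [/\ (forall x, (f x == c) = (x \in [:: w; a; b])),
            {in old &, injective f} &
            (forall y, exists x, y = f x)],
        {in old &, forall x y, adj (f x) (f y) = adj x y},
        {in old, forall x, adj c (f x) = adj a x || adj b x} &
        weight c = weight a + weight b /\
        {in old, forall x, weight (f x) = weight x}].

Definition neumann_top (bot top : plumbing_tree) : Prop :=
  (exists2 eps : int, eps = 1 \/ eps = -1 &
     moveA eps bot top \/ moveB eps bot top) \/
  moveC bot top.

Definition neumann_move (G H : plumbing_tree) : Prop :=
  neumann_top G H \/ neumann_top H G.

(* Main.v *)
Require Import Defs.
From HB Require Import structures.
From mathcomp Require Import all_boot all_order all_algebra all_field.
From mathcomp Require Import ring lra zify.

Set Implicit Arguments.
Unset Strict Implicit.
Unset Printing Implicit Defensive.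

Import Order.TTheory GRing.Theory Num.Theory.
Local Open Scope ring_scope.

(** Let B be the framing matrix and N the set of branch vertices.  Writing the
    vectors of the branch space as x B, weak negative definiteness says: whenever
    x is nonzero and x B is supported on N, x B x^T < 0.  In this form N may be
    any set of marked vertices, the invertibility of B is included (a kernel
    vector would violate the inequality), and marking every vertex gives
    negative definiteness.  So the marks are fixed once, on the branch vertices,
    and then carried along: later vertices of any degree may be marked or not.

    Root the tree at a marked vertex.  The unmarked vertices have at most one
    child each, hence form chains hanging below marked vertices.  The moves
    keep the condition when new vertices are left unmarked: a blow-up adds the
    square of a linear form, up to sign ([wneg_blowup_up],
    [wneg_blowup_down]); the contraction (C) restricts the form to the vectors
    orthogonal to the weight-0 vertex ([contraction_wneg]).  The edge
    signs that these substitutions produce are carried as extra data, since on a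
    tree they can be removed by changing signs of coordinates ([vertex_sign]).

    The chains are then normalised from the bottom up, as in the continued
    fraction algorithm ([reduce_step], [reduce_all]), until every unmarked
    weight is at most -2: a weight -1 is blown down, a weight 0 is contracted
    (at a leaf, together with its neighbour, see [clear_leaf_parent]), and a
    positive weight is lowered to 0 by blow-ups below it and then contracted
    ([absorb_pos]).  The only configuration where this stops is a weight 0 with
    only marked neighbours; its coordinate vector would be isotropic, against
    the hypothesis ([zero_isolated]).  At the end the unmarked block is
    negative definite ([unmarked_neg]), and together with the condition on N
    this makes B negative definite, by splitting off the unmarked block
    ([mxform_neg_block]).

    If there is no branch vertex, B is just invertible and nothing is marked.
    Attaching a new leaf of weight -1 at an end of the linear tree lowers the
    diagonal entry of the inverse of B at that end by 1 ([new_root_inverse]);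
    after finitely many steps the entry is negative and the end may be marked
    ([mark_root_norm_state]). *)

(** * Rooted labelled trees *)

(** A plumbing tree given by a parent function on natural number labels, so
    that the moves become pointwise updates.  [rk] decreases towards the root
    and witnesses that parents lead there.  [marked] is the set N of the
    argument above, [esgn v] says that the edge from [v] to its parent enters
    the form with a minus sign, and [todo] singles out, among the unmarked
    vertices, those whose chain is still to be normalised. *)
Record rtree := RTree {
  verts : seq nat; rt : nat; par : nat -> nat; rk : nat -> nat;
  wt : nat -> int; marked : nat -> bool; todo : nat -> bool; esgn : nat -> bool }.

Definition wf (T : rtree) := [/\ uniq (verts T), rt T \in verts T &
  forall v, v \in verts T -> v != rt T ->
    par T v \in verts T /\ (rk T (par T v) < rk T v)%N].

Definition child T p c := [&& c \in verts T, c != rt T & par T c == p].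

Definition adjT T x y :=
  (x != rt T) && (par T x == y) || (y != rt T) && (par T y == x).

(** Up to relabelling, and forgetting marks and signs. *)
Definition realize (G : plumbing_tree) T := exists phi : vertex G -> nat,
  [/\ injective phi, (forall u, u \in verts T <-> exists i, phi i = u),
      (forall i j, adj i j = adjT T (phi i) (phi j)) &
      (forall i, weight i = wt T (phi i))].

Lemma wf_parV T v : wf T -> v \in verts T -> v != rt T -> par T v \in verts T.
Proof. by case=> _ _ h vV vr; case: (h v vV vr). Qed.

Lemma wf_rk T v : wf T -> v \in verts T -> v != rt T -> (rk T (par T v) < rk T v)%N.
Proof. by case=> _ _ h vV vr; case: (h v vV vr). Qed.

Lemma wf_par_neq T v : wf T -> v \in verts T -> v != rt T -> par T v != v.
Proof.
by move=> h vV vr; apply/eqP=> e; have := wf_rk h vV vr; rewrite e ltnn.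
Qed.

Section OfRtree.
Variable T : rtree.
Hypothesis wfT : wf T.
Let n := size (verts T).
Let lb (i : 'I_n) := nth 0%N (verts T) i.
Let adjI (i j : 'I_n) := adjT T (lb i) (lb j).

Let lb_in i : lb i \in verts T. Proof. by rewrite mem_nth. Qed.

Let lb_inj : injective lb.
Proof.
case: wfT => u _ _ i j /eqP; rewrite nth_uniq ?ltn_ord // => /eqP.
exact: val_inj.
Qed.

Let lb_onto u : u \in verts T -> exists i, lb i = u.
Proof.
move=> uV; have lt : (index u (verts T) < n)%N by rewrite index_mem.
by exists (Ordinal lt); rewrite /lb nth_index.
Qed.

Let adjI_sym : symmetric adjI.
Proof. by move=> i j; rewrite /adjI /adjT orbC. Qed.

Let adjI_irr : irreflexive adjI.
Proof.
move=> i; rewrite /adjI /adjT orbb; case: eqP => //= /eqP h.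
by apply/negbTE/wf_par_neq.
Qed.

Let adjI_connected x y : connect adjI x y.
Proof.
have toroot k : forall i j, lb j = rt T -> (rk T (lb i) < k)%N -> connect adjI i j.
  elim: k => // k IH i j hj hk.
  case: (eqVneq (lb i) (rt T)) => [e|ne].
    by rewrite (_ : i = j) //; apply: lb_inj; rewrite e.
  have [i' hi'] := lb_onto (wf_parV wfT (lb_in i) ne).
  apply: (@connect_trans _ _ i').
    by apply: connect1; rewrite /adjI /adjT ne hi' eqxx.
  by apply: IH => //; rewrite hi'; apply: leq_trans (wf_rk wfT (lb_in i) ne) _.
have [_ rV _] := wfT; have [j hj] := lb_onto rV.
apply: (@connect_trans _ _ j); first exact: toroot (ltnSn _).
rewrite sym_connect_sym //; exact: toroot (ltnSn _).
Qed.

Let adjI_acyclic (c : seq 'I_n) : ucycle adjI c -> (size c <= 2)%N.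
Proof.
move=> cc; rewrite leqNgt; apply/negP=> sz.
have [i0 i0c] : exists i, i \in c.
  by case: c sz {cc} => // i c _; exists i; rewrite mem_head.
case: (@arg_maxnP _ i0 (mem c) (fun i => rk T (lb i)) i0c) => i ic imax.
case: (rot_to ic) => k c' def.
have sz' : (2 < size (i :: c'))%N by rewrite -def size_rot.
have cc' : ucycle adjI (i :: c') by rewrite -def rot_ucycle.
have sub j : j \in i :: c' -> (rk T (lb j) <= rk T (lb i))%N.
  by rewrite -def mem_rot; exact: imax.
have parE j : j \in i :: c' -> adjI i j -> par T (lb i) = lb j.
  move=> /sub jle; rewrite /adjI /adjT => /orP[/andP[_ /eqP//]|/andP[jr /eqP e]].
  by have := wf_rk wfT (lb_in j) jr; rewrite e ltnNge jle.
case: c' {def sub ic imax} sz' cc' parE => [//|j [//|k' c'']] _.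
rewrite /ucycle /= rcons_path => /andP[/and4P[aij _ _ ali]].
move=> /and4P[_ jN _ _] parE.
have lin : last k' c'' \in k' :: c'' by exact: mem_last.
have e1 := parE j; have e2 := parE (last k' c'').
have : lb j = lb (last k' c'').
  rewrite -e1 ?e2 // ?inE ?eqxx ?orbT //; last by rewrite adjI_sym.
  by move: lin; rewrite inE => ->; rewrite !orbT.
by move/lb_inj=> e; rewrite e lin in jN.
Qed.

(** On a cycle of length at least 3, a label of largest rank would have two
    distinct parents. *)
Lemma rtree_realizable : exists G, realize G T.
Proof.
have n0 : (0 < n)%N by case: wfT => _; rewrite /n; case: (verts T).
pose G := @PlumbingTree n adjI (fun i => wt T (lb i)) n0 adjI_sym adjI_irr
  adjI_connected adjI_acyclic.
exists G; exists lb; split=> // u; split=> [/lb_onto|[i <-]] //; exact: lb_in.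
Qed.

End OfRtree.

(** * Chains of moves *)

Definition reach (G H : plumbing_tree) := exists (N : nat) (F : nat -> plumbing_tree),
  [/\ F 0%N = G, F N = H & forall i, (i < N)%N -> neumann_move (F i) (F i.+1)].

Lemma reach_refl G : reach G G.
Proof. by exists 0%N, (fun=> G). Qed.

Lemma reach_step G H : neumann_move G H -> reach G H.
Proof. by move=> m; exists 1%N, (fun i => if i is 0%N then G else H);
  split=> // -[]. Qed.

Lemma reach_trans G H K : reach G H -> reach H K -> reach G K.
Proof.
move=> [N [F [F0 FN FS]]] [M [E [E0 EM ES]]].
exists (N + M)%N, (fun i => if (i <= N)%N then F i else E (i - N)%N); split=> //=.
  case: leqP => [|_]; last by rewrite addKn.
  by rewrite -{2}[N]addn0 leq_add2l leqn0 => /eqP M0; rewrite -EM M0 addn0 FN E0.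
move=> i lti; case: (ltngtP i N) lti => [lt|gt|->] lti.
- exact: FS.
- by rewrite subSn 1?ltnW //; apply: ES; rewrite -(ltn_add2l N) subnKC // ltnW.
- rewrite subSn // subnn FN -E0; apply: ES; case: (M) lti => // .
  by rewrite addn0 ltnn.
Qed.

(** Quantifying over all realizations of the source absorbs relabellings, so
    steps compose without any isomorphism being mentioned. *)
Definition tree_reach T T' := forall G, realize G T -> exists2 H, realize H T' &
  reach G H.

Lemma tree_reach_refl T : tree_reach T T.
Proof. by move=> G GT; exists G => //; apply: reach_refl. Qed.

Lemma tree_reach_trans T1 T2 T3 : tree_reach T1 T2 -> tree_reach T2 T3 ->
  tree_reach T1 T3.
Proof.
move=> r12 r23 G /r12[H /r23[K KT HK] GH]; exists K => //.
exact: reach_trans HK.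
Qed.

Lemma neumann_move_sym G H : neumann_move G H -> neumann_move H G.
Proof. by case; [right | left]. Qed.

(** * The signed form and marked definiteness *)

Definition term T (x y : nat -> rat) v : rat :=
  (wt T v)%:~R * x v * y v +
  (if v == rt T then 0
   else (-1) ^+ esgn T v * (x v * y (par T v) + x (par T v) * y v)).

Definition form T x y := \sum_(v <- verts T) term T x y v.

Definition delta u : nat -> rat := fun v => (v == u)%:R.

(** The image of [x] under the form is supported on the marked vertices. *)
Definition orth T x :=
  forall u, u \in verts T -> ~~ marked T u -> form T x (delta u) = 0.

Definition nontriv T (x : nat -> rat) := exists2 v, v \in verts T & x v != 0.

Definition wneg T := forall x, nontriv T x -> orth T x -> form T x x < 0.

Lemma formC T x y : form T x y = form T y x.
Proof. by apply: eq_bigr => v _; rewrite /term; case: eqP => _; ring. Qed.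

Lemma form_lin T x y z a :
  form T x (fun v => a * y v + z v) = a * form T x y + form T x z.
Proof.
rewrite /form big_distrr -big_split /=; apply: eq_bigr => v _.
by rewrite /term; case: eqP => _; ring.
Qed.

Lemma form_lin_l T x y z a :
  form T (fun v => a * y v + z v) x = a * form T y x + form T z x.
Proof. by rewrite formC form_lin !(formC _ x). Qed.

Lemma form_ext T x x' y y' : wf T -> {in verts T, x =1 x'} ->
  {in verts T, y =1 y'} -> form T x y = form T x' y'.
Proof.
move=> wfT ex ey; apply: eq_big_seq => v vV; rewrite /term (ex v vV) (ey v vV).
by case: eqVneq => // vr; rewrite (ex _ (wf_parV wfT vV vr)) (ey _ (wf_parV wfT vV vr)).
Qed.

Lemma form0 T x y : wf T -> {in verts T, forall v, y v = 0} -> form T x y = 0.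
Proof.
move=> wfT ey; rewrite (form_ext (x' := x) (y' := fun=> 0)) //.
by rewrite /form big1 // => v _; rewrite /term; case: eqP => _; ring.
Qed.

Lemma sum_delta (s : seq nat) p (E : rat) : uniq s -> p \in s ->
  \sum_(u <- s) (if u == p then E else 0) = E.
Proof.
move=> us ps; rewrite (bigD1_seq p) //= eqxx big1 ?addr0 // => u /negbTE ->//.
Qed.

Lemma form_expand T x y : wf T ->
  form T x y = \sum_(u <- verts T) y u * form T x (delta u).
Proof.
move=> wfT; have lin s : form T x (fun v => \sum_(u <- s) y u * delta u v) =
    \sum_(u <- s) y u * form T x (delta u).
  elim: s => [|u s IH].
    by rewrite big_nil form0 // => v _; rewrite big_nil.
  rewrite big_cons -IH -form_lin; apply: form_ext => // v _.
  by rewrite big_cons.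
rewrite -lin; apply: form_ext => // v vV.
rewrite -{1}[y v](@sum_delta (verts T) v) //; last by case: wfT.
by apply: eq_bigr => u _; rewrite /delta eq_sym; case: eqP => [->|_] /=; ring.
Qed.

(** A blow-up at [w] adds e times the square of a linear form that involves
    the coordinate of [w] with coefficient 1.  If [x] is orthogonal to the
    unmarked [w], that linear form vanishes at [x], and both forms agree on
    [x] and on every vector paired with it. *)
Lemma wneg_blowup_up bot top w v p (e a b : rat) :
  wf bot -> wf top -> perm_eq (verts top) (w :: verts bot) ->
  v \in verts bot -> p \in verts bot -> e != 0 ->
  {in verts bot, marked top =1 marked bot} -> ~~ marked top w ->
  (forall x y, form top x y = form bot x y +
     e * (x w + a * x v + b * x p) * (y w + a * y v + b * y p)) ->
  wneg bot -> wneg top.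
Proof.
move=> wfb wft pV vV pV' e0 mE mw fE wb x [u uV xu] ox.
have wV : w \in verts top by rewrite (perm_mem pV) mem_head.
have wN : w \notin verts bot.
  by have [] := wft; rewrite (perm_uniq pV) /= => /andP[].
have neq u' : u' \in verts bot -> (u' == w) = false.
  by move=> u'V; apply: contraNF wN => /eqP <-.
have l0 : x w + a * x v + b * x p = 0.
  have := ox w wV mw; rewrite fE (form0 _ wfb) ?add0r; last first.
    by move=> u' u'V; rewrite /delta neq.
  rewrite /delta eqxx !neq // !mulr0 !addr0 mulr1 => /eqP.
  by rewrite mulf_eq0 (negbTE e0) /= => /eqP.
have f y : form top x y = form bot x y by rewrite fE l0 mulr0 mul0r addr0.
rewrite f; apply: wb.
  move: uV; rewrite (perm_mem pV) inE => /orP[/eqP uw|]; last by exists u.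
  have [xv|] := eqVneq (x v) 0; last by exists v.
  have [xp|] := eqVneq (x p) 0; last by exists p.
  by move: xu; rewrite uw; move: l0; rewrite xv xp !mulr0 !addr0 => ->; rewrite eqxx.
move=> u' u'V mu'; rewrite -f; apply: ox; last by rewrite mE.
by rewrite (perm_mem pV) inE u'V orbT.
Qed.

(** Conversely, a vector below extends uniquely to one at which the linear form
    vanishes. *)
Lemma wneg_blowup_down bot top w v p (e a b : rat) :
  wf bot -> wf top -> perm_eq (verts top) (w :: verts bot) ->
  v \in verts bot -> p \in verts bot ->
  {in verts bot, marked top =1 marked bot} ->
  (forall x y, form top x y = form bot x y +
     e * (x w + a * x v + b * x p) * (y w + a * y v + b * y p)) ->
  wneg top -> wneg bot.
Proof.
move=> wfb wft pV vV pV' mE fE wt' x [u uV xu] ox.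
have wN : w \notin verts bot.
  by have [] := wft; rewrite (perm_uniq pV) /= => /andP[].
have neq u' : u' \in verts bot -> (u' == w) = false.
  by move=> u'V; apply: contraNF wN => /eqP <-.
pose x' u := if u == w then - (a * x v + b * x p) else x u.
have x'E : {in verts bot, x' =1 x} by move=> u' /neq; rewrite /x' => ->.
have f y : form top x' y = form bot x y.
  rewrite fE {1 2}/x' eqxx !x'E // (form_ext (x' := x) (y' := y)) //.
  by ring.
rewrite -(form_ext (x := x) (y := x') wfb) // -f; apply: wt'.
  by exists u; rewrite ?x'E // (perm_mem pV) inE uV orbT.
move=> u'; rewrite f (perm_mem pV) inE => /orP[/eqP -> _|u'V mu'].
  by apply: form0 => // z zV; rewrite /delta neq.
by apply: ox => //; rewrite -mE.
Qed.

(** * Blow-up of an edge *)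

(** Stated as a relation so that it serves for blowing up and down.  The sign
    (-1)^e is the weight of the new vertex [w], placed between [v] and its
    former parent. The sign rule for the edges at [w] is what makes the cross
    term of the added square cancel the removed edge. *)
Record edge_blowup (e : bool) bot top w v : Prop := EdgeBlowup {
  edge_blowup_V : perm_eq (verts top) (w :: verts bot);
  edge_blowup_rt : rt top = rt bot;
  edge_blowup_v : v \in verts bot;
  edge_blowup_vr : v != rt bot;
  edge_blowup_parv : par top v = w;
  edge_blowup_par : {in verts bot, forall u, par bot u = if u == v then par top w
    else par top u};
  edge_blowup_wtw : wt top w = (-1) ^+ e;
  edge_blowup_wt : {in verts bot, forall u, wt top u =
     wt bot u + (if (u == v) || (u == par top w) then (-1) ^+ e else 0)};
  edge_blowup_mw : ~~ marked top w;
  edge_blowup_m : {in verts bot, marked top =1 marked bot};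
  edge_blowup_s : {in verts bot, forall u, esgn bot u =
     if u == v then ~~ (e (+) esgn top v (+) esgn top w) else esgn top u} }.

Section EdgeBlowup.
Variables (e : bool) (bot top : rtree) (w v : nat).
Hypotheses (wfb : wf bot) (wft : wf top) (R : edge_blowup e bot top w v).
Let p := par top w.

Lemma edge_blowup_wN : w \notin verts bot.
Proof. by have [] := wft; rewrite (perm_uniq (edge_blowup_V R)) /= => /andP[]. Qed.

Lemma edge_blowup_pE : p = par bot v.
Proof. by rewrite (edge_blowup_par R) ?(edge_blowup_v R) // eqxx. Qed.

Lemma edge_blowup_pV : p \in verts bot.
Proof. by rewrite edge_blowup_pE; apply: wf_parV;
  rewrite ?(edge_blowup_v R) ?(edge_blowup_vr R). Qed.

Lemma edge_blowup_neq u : u \in verts bot -> (u == w) = false.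
Proof. by move=> uV; apply: contraNF edge_blowup_wN => /eqP <-. Qed.

Lemma edge_blowup_pv : (p == v) = false.
Proof. by apply/negbTE; rewrite edge_blowup_pE wf_par_neq ?(edge_blowup_v R)
  ?(edge_blowup_vr R). Qed.

Lemma edge_blowup_wr : w != rt top.
Proof.
apply/eqP=> h; have [_ rV _] := wfb; move: edge_blowup_wN.
by rewrite h (edge_blowup_rt R) rV.
Qed.

(** Completing the square in the coordinate of [w]. *)
Lemma edge_blowup_form x y : form top x y = form bot x y + (-1) ^+ e *
  (x w + (-1) ^+ (e (+) esgn top v) * x v + (-1) ^+ (e (+) esgn top w) * x p) *
  (y w + (-1) ^+ (e (+) esgn top v) * y v + (-1) ^+ (e (+) esgn top w) * y p).
Proof.
have vV := edge_blowup_v R; have ub : uniq (verts bot) by case: wfb.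
rewrite /form (perm_big _ (edge_blowup_V R)) big_cons /=.
pose D : rat := (-1) ^+ e * x v * y v + (-1) ^+ esgn top v * (x v * y w + x w * y v)
  - (-1) ^+ esgn bot v * (x v * y p + x p * y v).
rewrite (eq_big_seq (fun u => term bot x y u +
   ((if u == p then (-1) ^+ e * x p * y p else 0) + (if u == v then D else 0)))).
  rewrite !big_split !sum_delta ?edge_blowup_pV //.
  rewrite /D /term (edge_blowup_s R vV) eqxx (negbTE edge_blowup_wr) (edge_blowup_wtw
    R) -/p.
  by case: (e); case: (esgn top v); case: (esgn top w); rewrite /= ?expr1 ?expr0 ; ring.
move=> u uV; rewrite /term (edge_blowup_wt R uV) (edge_blowup_rt R) -/p.
case: (eqVneq u v) => [->|uv].
  rewrite (eq_sym v p) edge_blowup_pv (negbTE (edge_blowup_vr R)) (edge_blowup_parv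
    R) -edge_blowup_pE /D /=.
  by rewrite rmorphD rmorph_sign; ring.
rewrite (edge_blowup_par R uV) (edge_blowup_s R uV) (negbTE uv).
case: (eqVneq u p) => [->|up] /=; case: eqVneq => _;
  rewrite ?rmorphD /= ?rmorph_sign; ring.
Qed.

Lemma edge_blowup_wneg_up : wneg bot -> wneg top.
Proof.
apply: (wneg_blowup_up wfb wft (edge_blowup_V R) (edge_blowup_v R) edge_blowup_pV _
  (edge_blowup_m R) (edge_blowup_mw R) edge_blowup_form).
by rewrite signr_eq0.
Qed.

Lemma edge_blowup_wneg_down : wneg top -> wneg bot.
Proof.
exact: (wneg_blowup_down wfb wft (edge_blowup_V R) (edge_blowup_v R) edge_blowup_pV
  (edge_blowup_m R) edge_blowup_form).
Qed.

Lemma edge_blowup_adj x y : x \in verts bot -> y \in verts bot ->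
  adjT top x y = adjT bot x y && ~~ ((x == v) && (y == p) || (x == p) && (y == v)).
Proof.
move=> xV yV; rewrite /adjT (edge_blowup_rt R) (edge_blowup_par R xV)
  (edge_blowup_par R yV) -/p.
have pv := edge_blowup_pv; have vr := edge_blowup_vr R; have pvw := edge_blowup_parv R.
have pp : (p != rt bot) && (par top p == v) = false.
  apply/negP=> /andP[pr /eqP h]; have := wf_rk wfb edge_blowup_pV pr.
  rewrite (edge_blowup_par R edge_blowup_pV) ifF ?pv // h edge_blowup_pE ltnNge ltnW //.
  by apply: wf_rk; rewrite ?(edge_blowup_v R).
case: (eqVneq x v) => [->|xv]; case: (eqVneq y v) => [->|yv].
- by rewrite pvw (eq_sym w) edge_blowup_neq ?(edge_blowup_v R) // pv !andbF.
- rewrite pvw (eq_sym w) (edge_blowup_neq yV) (eq_sym v p) pv !andbF vr (eq_sym p) /=.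
  by case: (eqVneq y p) => [->|_]; rewrite ?pp ?andbT ?orbF.
- rewrite pvw (eq_sym w) (edge_blowup_neq xV) (eq_sym v p) pv !andbF vr (eq_sym p) /=.
  by case: (eqVneq x p) => [->|_]; rewrite ?pp ?andbT ?orbF.
- by rewrite !andbF andbT.
Qed.

Lemma edge_blowup_adjw x : x \in verts bot -> adjT top w x = (x == p) || (x == v).
Proof.
move=> xV; rewrite /adjT edge_blowup_wr (edge_blowup_rt R) /= -/p (eq_sym p).
case: (eqVneq x v) => [->|xv]; first by rewrite (edge_blowup_vr R) (edge_blowup_parv
  R) eqxx.
case: (eqVneq x p) => //= xp; apply/negP=> /andP[xr /eqP h].
have := wf_parV wfb xV xr; rewrite (edge_blowup_par R xV) (negbTE xv) h.
by rewrite (negbTE edge_blowup_wN).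
Qed.

End EdgeBlowup.

(** * From labels to Neumann moves *)

Lemma vertex_map (G H : plumbing_tree) (T T' : rtree) (phi : vertex G -> nat)
    (psi : vertex H -> nat) (g : nat -> nat) :
  (forall u, u \in verts T <-> exists i, phi i = u) ->
  (forall u, u \in verts T' <-> exists i, psi i = u) ->
  {in verts T, forall u, g u \in verts T'} ->
  exists f : vertex G -> vertex H, forall i, psi (f i) = g (phi i).
Proof.
move=> hphi hpsi hg.
exists (fun i => odflt (Ordinal (pt_nonempty H)) [pick j | psi j == g (phi i)]).
move=> i; case: pickP => /= [j /eqP //|none].
have /hg/hpsi[j jE] : phi i \in verts T by apply/hphi; exists i.
by have := none j; rewrite jE eqxx.
Qed.

Lemma inj_eqE (A : finType) (phi : A -> nat) : injective phi ->
  forall i j, (i == j) = (phi i == phi j).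
Proof. by move=> h i j; rewrite (inj_eq h). Qed.

Section AddVertex.
Variables (G H : plumbing_tree) (bot top : rtree) (w : nat).
Variables (phi : vertex G -> nat) (psi : vertex H -> nat).
Hypotheses (phi_inj : injective phi) (psi_inj : injective psi).
Hypothesis phiV : forall u, u \in verts bot <-> exists i, phi i = u.
Hypothesis psiV : forall u, u \in verts top <-> exists i, psi i = u.
Hypothesis (pV : perm_eq (verts top) (w :: verts bot)) (wN : w \notin verts bot).

Lemma adds_vertex_label : exists (f : vertex G -> vertex H) (w' : vertex H),
  [/\ adds_vertex f w', forall i, psi (f i) = phi i & psi w' = w].
Proof.
have [f fE] : exists f : vertex G -> vertex H, forall i, psi (f i) = phi i.
  apply: (vertex_map (g := id) phiV psiV) => u uV.
  by rewrite (perm_mem pV) inE uV orbT.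
have /psiV[w' w'E] : w \in verts top by rewrite (perm_mem pV) mem_head.
exists f, w'; split=> //; split=> [i j /(congr1 psi)|j];
  first by rewrite !fE => /phi_inj.
rewrite (inj_eqE psi_inj) w'E; split=> [jw|[i ->]].
  have : psi j \in verts top by apply/psiV; exists j.
  rewrite (perm_mem pV) inE (negbTE jw) /= => /phiV[i iE].
  by exists i; apply: psi_inj; rewrite fE.
by rewrite fE; apply: contraNneq wN => <-; apply/phiV; exists i.
Qed.
End AddVertex.

Lemma moveA_label G H bot top w v p (e : bool) :
  realize G bot -> realize H top ->
  perm_eq (verts top) (w :: verts bot) -> w \notin verts bot ->
  v \in verts bot -> p \in verts bot -> adjT bot v p ->
  {in verts bot &, forall x y, adjT top x y = adjT bot x y &&
     ~~ ((x == v) && (y == p) || (x == p) && (y == v))} ->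
  {in verts bot, forall x, adjT top w x = (x == p) || (x == v)} ->
  wt top w = (-1) ^+ e ->
  {in verts bot, forall x, wt top x = wt bot x + (if (x == v) || (x == p) then (-1)
    ^+ e else 0)} ->
  neumann_move G H.
Proof.
move=> [phi [phi_inj phiV phiA phiW]] [psi [psi_inj psiV psiA psiW]] pV wN vV pV' avp
  aE awE ww wE.
left; left; exists ((-1) ^+ e); first by case: (e); [right | left].
left; have [f [w' [fw fE w'E]]] := adds_vertex_label phi_inj psi_inj phiV psiV pV wN.
have [i iE] := (phiV v).1 vV; have [j jE] := (phiV p).1 pV'.
have inV k : phi k \in verts bot by apply/phiV; exists k.
exists f, w', i, j; split=> // [|x y|x|].
- by rewrite phiA iE jE.
- by rewrite psiA !fE aE // phiA !(inj_eqE phi_inj) iE jE.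
- by rewrite psiA w'E fE awE // !(inj_eqE phi_inj) iE jE orbC.
- split=> [|x]; first by rewrite psiW w'E.
  rewrite psiW fE wE // !(inj_eqE phi_inj) iE jE phiW.
  by case: ifP => // _; rewrite addr0.
Qed.

Lemma moveB_label G H bot top w u (e : bool) :
  realize G bot -> realize H top ->
  perm_eq (verts top) (w :: verts bot) -> w \notin verts bot ->
  u \in verts bot ->
  {in verts bot &, forall x y, adjT top x y = adjT bot x y} ->
  {in verts bot, forall x, adjT top w x = (x == u)} ->
  wt top w = (-1) ^+ e ->
  {in verts bot, forall x, wt top x = wt bot x + (if x == u then (-1) ^+ e else 0)} ->
  neumann_move G H.
Proof.
move=> [phi [phi_inj phiV phiA phiW]] [psi [psi_inj psiV psiA psiW]] pV wN uV aE awE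
  ww wE.
left; left; exists ((-1) ^+ e); first by case: (e); [right | left].
right; have [f [w' [fw fE w'E]]] := adds_vertex_label phi_inj psi_inj phiV psiV pV wN.
have [i iE] := (phiV u).1 uV.
have inV k : phi k \in verts bot by apply/phiV; exists k.
exists f, w', i; split=> // [x y|x|].
- by rewrite psiA !fE aE // phiA.
- by rewrite psiA w'E fE awE // !(inj_eqE phi_inj) iE.
- split=> [|x]; first by rewrite psiW w'E.
  rewrite psiW fE wE // !(inj_eqE phi_inj) iE phiW.
  by case: ifP => // _; rewrite addr0.
Qed.

Lemma moveC_label G H bot top w a b :
  realize G bot -> realize H top ->
  perm_eq (verts top) [:: w, b & verts bot] -> uniq (verts top) ->
  a \in verts bot ->
  {in verts bot &, forall x y, x != a -> y != a -> adjT bot x y = adjT top x y} ->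
  {in verts bot, forall x, x != a -> adjT bot a x = adjT top a x || adjT top b x} ->
  {in verts top, forall x, adjT top w x = (x == a) || (x == b)} ->
  wt top w = 0 -> wt bot a = wt top a + wt top b ->
  {in verts bot, forall x, x != a -> wt bot x = wt top x} ->
  neumann_move G H.
Proof.
move=> [phi [phi_inj phiV phiA phiW]] [psi [psi_inj psiV psiA psiW]] pV uq aV aE acE
  awE ww wa wE.
have /and3P[wN bN ub] : [&& w \notin b :: verts bot, b \notin verts bot &
  uniq (verts bot)].
  by move: uq; rewrite (perm_uniq pV).
have ab : (a == b) = false by apply: contraNF bN => /eqP <-.
have aw : (a == w) = false by apply: contraNF wN => /eqP <-; rewrite inE aV orbT.
have inT k : psi k \in verts top by apply/psiV; exists k.
pose g u := if (u == w) || (u == b) then a else u.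
have gV u : u \in verts top -> g u \in verts bot.
  by rewrite (perm_mem pV) !inE /g orbA; case: ifP.
have [f fE] := vertex_map psiV phiV gV.
have [w' w'E] : exists i, psi i = w by apply/psiV; rewrite (perm_mem pV) !inE eqxx.
have [b' b'E] : exists i, psi i = b by apply/psiV; rewrite (perm_mem pV) !inE eqxx orbT.
have [a' a'E] : exists i, psi i = a by apply/psiV; rewrite (perm_mem pV) !inE aV !orbT.
have [c cE] := (phiV a).1 aV.
have E := inj_eqE psi_inj.
have oldP x : x \notin [:: w'; a'; b'] ->
    [/\ phi (f x) = psi x, psi x != a & psi x \in verts bot].
  rewrite !inE !E w'E a'E b'E fE /g !negb_or => /and3P[xw xa xb].
  rewrite (negbTE xw) (negbTE xb) xa; split=> //.
  by have := inT x; rewrite (perm_mem pV) !inE (negbTE xw) (negbTE xb).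
left; right; exists f, w', a', b', c; split.
- split.
  + by rewrite psiW w'E.
  + rewrite /degree (_ : [set x | adj w' x] = [set a'; b']).
      by rewrite cards2 E a'E b'E ab.
    by apply/setP=> x; rewrite !inE psiA w'E awE ?inT // !E a'E b'E.
  + by rewrite psiA w'E awE ?inT // a'E eqxx.
  + by rewrite psiA w'E awE ?inT // b'E eqxx orbT.
  + by rewrite E a'E b'E ab.
- split.
  + move=> x; rewrite (inj_eqE phi_inj) fE cE !inE !E w'E a'E b'E /g.
    by case: (psi x == w) (psi x == b) => [] []; rewrite /= ?eqxx ?orbT ?orbF.
  + move=> x y /oldP[xE _ _] /oldP[yE _ _] /(congr1 phi).
    by rewrite xE yE => /psi_inj.
  + move=> y; have yV : phi y \in verts bot by apply/phiV; exists y.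
    have [x xE] : exists i, psi i = (phi y) by apply/psiV;
      rewrite (perm_mem pV) !inE yV !orbT.
    exists x; apply: phi_inj; rewrite fE xE /g.
    have -> : (phi y == w) = false by apply: contraNF wN => /eqP <-;
      rewrite inE yV orbT.
    by have -> : (phi y == b) = false by apply: contraNF bN => /eqP <-.
- by move=> x y /oldP[xE xa xV] /oldP[yE ya yV]; rewrite phiA xE yE aE // psiA.
- by move=> x /oldP[xE xa xV]; rewrite phiA xE cE acE // !psiA a'E b'E.
- split; first by rewrite phiW cE wa !psiW a'E b'E.
  by move=> x /oldP[xE xa xV]; rewrite phiW xE wE // psiW.
Qed.

Lemma edge_blowup_move e bot top w v G H : wf bot -> wf top ->
  edge_blowup e bot top w v ->
  realize G bot -> realize H top -> neumann_move G H.
Proof.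
move=> wfb wft R GB HT.
apply: (moveA_label (v := v) (p := par top w) GB HT (edge_blowup_V R) (edge_blowup_wN
  wft R)).
- exact: edge_blowup_v R.
- exact: edge_blowup_pV R.
- by rewrite /adjT (edge_blowup_vr R) (edge_blowup_pE R) eqxx.
- by move=> x y xV yV; exact: (edge_blowup_adj wfb wft R xV yV).
- by move=> x xV; exact: (edge_blowup_adjw wfb wft R xV).
- exact: edge_blowup_wtw R.
- exact: edge_blowup_wt R.
Qed.

(** * Blow-up of a vertex *)

Record vertex_blowup (e : bool) bot top w u : Prop := VertexBlowup {
  vertex_blowup_V : perm_eq (verts top) (w :: verts bot);
  vertex_blowup_rt : rt top = rt bot;
  vertex_blowup_u : u \in verts bot;
  vertex_blowup_parw : par top w = u;
  vertex_blowup_par : {in verts bot, par top =1 par bot};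
  vertex_blowup_wtw : wt top w = (-1) ^+ e;
  vertex_blowup_wt : {in verts bot, forall x, wt top x =
     wt bot x + (if x == u then (-1) ^+ e else 0)};
  vertex_blowup_mw : ~~ marked top w;
  vertex_blowup_m : {in verts bot, marked top =1 marked bot};
  vertex_blowup_s : {in verts bot, esgn top =1 esgn bot} }.

Section VertexBlowup.
Variables (e : bool) (bot top : rtree) (w u : nat).
Hypotheses (wfb : wf bot) (wft : wf top) (R : vertex_blowup e bot top w u).

Lemma vertex_blowup_wN : w \notin verts bot.
Proof. by have [] := wft; rewrite (perm_uniq (vertex_blowup_V R)) /= => /andP[]. Qed.

Lemma vertex_blowup_wr : w != rt top.
Proof.
apply/eqP=> h; have [_ rV _] := wfb; move: vertex_blowup_wN.
by rewrite h (vertex_blowup_rt R) rV.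
Qed.

(** The term with coefficient 0 matches the shape used for edges, where the
    linear form also involves a second old vertex. *)
Lemma vertex_blowup_form x y : form top x y = form bot x y + (-1) ^+ e *
  (x w + (-1) ^+ (e (+) esgn top w) * x u + 0 * x u) *
  (y w + (-1) ^+ (e (+) esgn top w) * y u + 0 * y u).
Proof.
have ub : uniq (verts bot) by case: wfb.
rewrite /form (perm_big _ (vertex_blowup_V R)) big_cons /=.
rewrite (eq_big_seq (fun v => term bot x y v +
   (if v == u then (-1) ^+ e * x u * y u else 0))).
  rewrite !big_split !sum_delta ?(vertex_blowup_u R) //.
  rewrite /term (negbTE vertex_blowup_wr) (vertex_blowup_wtw R) (vertex_blowup_parw R).
  by case: (e); case: (esgn top w); rewrite /= ?expr1 ?expr0; ring.
move=> v vV; rewrite /term (vertex_blowup_wt R vV) (vertex_blowup_rt R)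
  (vertex_blowup_par R vV) (vertex_blowup_s R vV).
by case: (eqVneq v u) => [->|uv]; case: eqVneq => _;
  rewrite ?rmorphD /= ?rmorph_sign; ring.
Qed.

Lemma vertex_blowup_wneg_up : wneg bot -> wneg top.
Proof.
apply: (wneg_blowup_up wfb wft (vertex_blowup_V R) (vertex_blowup_u R)
  (vertex_blowup_u R) _ (vertex_blowup_m R) (vertex_blowup_mw R) vertex_blowup_form).
by rewrite signr_eq0.
Qed.

Lemma vertex_blowup_wneg_down : wneg top -> wneg bot.
Proof.
exact: (wneg_blowup_down wfb wft (vertex_blowup_V R) (vertex_blowup_u R)
  (vertex_blowup_u R) (vertex_blowup_m R) vertex_blowup_form).
Qed.

Lemma vertex_blowup_move G H : realize G bot -> realize H top -> neumann_move G H.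
Proof.
move=> GB HT; apply: (moveB_label GB HT (vertex_blowup_V R) vertex_blowup_wN
  (vertex_blowup_u R)).
- by move=> x y xV yV; rewrite /adjT (vertex_blowup_rt R) !(vertex_blowup_par R).
- move=> x xV; rewrite /adjT vertex_blowup_wr (vertex_blowup_rt R)
  (vertex_blowup_parw R) (vertex_blowup_par R xV) eq_sym /=.
  case: (eqVneq x u) => //= xu; apply/negP=> /andP[xr /eqP h].
  by have := wf_parV wfb xV xr; rewrite h (negbTE vertex_blowup_wN).
- exact: vertex_blowup_wtw R.
- exact: vertex_blowup_wt R.
Qed.
End VertexBlowup.

(** * Contraction of a vertex of weight 0 *)

(** The merged vertex keeps the label of the parent of [w]. *)
Record contraction bot top w b : Prop := Contraction {
  contraction_V : perm_eq (verts top) [:: w, b & verts bot];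
  contraction_rt : rt top = rt bot;
  contraction_wr : w != rt top;
  contraction_br : b != rt top;
  contraction_parb : par top b = w;
  contraction_uniq : forall c, child top w c -> c = b;
  contraction_par : {in verts bot, forall u,
    par bot u = if par top u == b then par top w else par top u};
  contraction_wtw : wt top w = 0;
  contraction_wta : wt bot (par top w) = wt top (par top w) + wt top b;
  contraction_wt : {in verts bot, forall u, u != par top w -> wt bot u = wt top u};
  contraction_mw : ~~ marked top w;
  contraction_ma : marked bot (par top w) = marked top (par top w) || marked top b;
  contraction_m : {in verts bot, forall u, u != par top w ->
    marked bot u = marked top u};
  contraction_s : {in verts bot, forall u, esgn bot u =
     if par top u == b then ~~ (esgn top w (+) esgn top b (+) esgn top u)
     else esgn top u} }.

Section Contraction.
Variables (bot top : rtree) (w b : nat).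
Hypotheses (wfb : wf bot) (wft : wf top) (R : contraction bot top w b).
Let a := par top w.
Let sw : rat := (-1) ^+ esgn top w.
Let sb : rat := (-1) ^+ esgn top b.

Let uniqs : [&& w \notin b :: verts bot, b \notin verts bot & uniq (verts bot)].
Proof. by case: wft; rewrite (perm_uniq (contraction_V R)). Qed.
Let wT : w \in verts top. Proof. by rewrite (perm_mem (contraction_V R)) !inE eqxx. Qed.
Let bT : b \in verts top. Proof. by rewrite (perm_mem (contraction_V R)) !inE eqxx
  orbT. Qed.
Let sub u : u \in verts bot -> u \in verts top.
Proof. by move=> uV; rewrite (perm_mem (contraction_V R)) !inE uV !orbT. Qed.
Let nb u : u \in verts bot -> (u == b) = false.
Proof. by case/and3P: uniqs => _ h _ uV; apply: contraNF h => /eqP <-. Qed.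
Let nw u : u \in verts bot -> (u == w) = false.
Proof. by case/and3P: uniqs => h _ _ uV; apply: contraNF h => /eqP <-;
  rewrite inE uV orbT. Qed.
Let wb : (w == b) = false.
Proof. by case/and3P: uniqs; rewrite inE negb_or => /andP[/negbTE]. Qed.
Let aT : a \in verts top. Proof. exact: wf_parV wft wT (contraction_wr R). Qed.
Let rka : (rk top a < rk top w)%N. Proof. exact: wf_rk wft wT (contraction_wr R). Qed.
Let rkw : (rk top w < rk top b)%N.
Proof. by rewrite -{1}(contraction_parb R); apply: wf_rk wft bT (contraction_br R). Qed.
Let aV : a \in verts bot.
Proof.
have := aT; rewrite (perm_mem (contraction_V R)) !inE => /or3P[/eqP h|/eqP h|//].
  by move: rka; rewrite h ltnn.
by move: (ltn_trans rka rkw); rewrite h ltnn.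
Qed.

Lemma contraction_orthw x : form top x (delta w) = sw * x a + sb * x b.
Proof.
rewrite /form (perm_big _ (contraction_V R)) !big_cons /= big1_seq => [|u /= uV].
  rewrite addr0 /term (negbTE (contraction_wr R)) (negbTE (contraction_br R))
    (contraction_wtw R) (contraction_parb R).
  by rewrite /delta eqxx (eq_sym b) wb -/a nw // -/sw -/sb /=; ring.
rewrite /term /delta nw //; case: eqVneq => ur /=; first by ring.
have -> : (par top u == w) = false.
  apply/negbTE/eqP=> h; have := nb uV; rewrite (contraction_uniq R (c := u)) ?eqxx //.
  by rewrite /child sub // ur h eqxx.
by rewrite /=; ring.
Qed.

(** Orthogonality to [w] forces the coordinate of [b] to be that of the parent
    of [w], up to sign.  Eliminating it leaves the form of the contracted
    tree; the children of [b] pick up the sign, which is why their edge signs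
    change. *)
Lemma contraction_form x y : x b = - (sw * sb) * x a -> y b = - (sw * sb) * y a ->
  form top x y = form bot x y.
Proof.
move=> xb yb; have ub : uniq (verts bot) by case/and3P: uniqs.
rewrite /form (perm_big _ (contraction_V R)) !big_cons /=.
rewrite [RHS](eq_big_seq (fun u => term top x y u +
   (if u == a then (wt top b)%:~R * x a * y a else 0))).
  rewrite [in RHS]big_split /= sum_delta //= /term (negbTE (contraction_wr R))
    (negbTE (contraction_br R)).
  rewrite (contraction_wtw R) (contraction_parb R) -/a xb yb /sw /sb.
  by case: (esgn top b); case: (esgn top w); rewrite /= ?expr1 ?expr0; ring.
move=> u uV; rewrite /term (contraction_rt R) (contraction_par R uV) (contraction_s R
  uV) -/a.
have -> : (wt bot u)%:~R = (wt top u)%:~R + (if u == a then (wt top b)%:~R else 0) :>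
  rat.
  case: eqVneq => [->|ua]; first by rewrite (contraction_wta R) rmorphD.
  by rewrite addr0 (contraction_wt R uV ua).
case: (eqVneq (par top u) b) => [pb|pb].
  rewrite pb xb yb /sw /sb.
  case: (esgn top u); case: (esgn top b); case: (esgn top w);
    case: (eqVneq u a) => [->|_]; case: eqP => _; rewrite /= ?expr1 ?expr0; ring.
by case: (eqVneq u a) => [->|_]; case: eqP => _; ring.
Qed.

(** A vector below lifts by choosing the coordinates of [w] and [b].  The one
    of [b] is dictated by orthogonality to [w]; the one of [w] is free and can
    be used to make the lift orthogonal to one further vertex, an unmarked one
    among [b] and the parent of [w].  If both were marked, the merged vertex
    would stand for two marks, and the implication can fail. *)
Lemma contraction_wneg : ~~ (marked top a && marked top b) -> wneg top -> wneg bot.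
Proof.
move=> mab wt' y [u uV yu] oy.
pose k := - (sw * sb).
pose x0 v := if v == b then k * y a else y v.
(* The unmarked neighbour of w to which the lift is made orthogonal. *)
pose d := if marked top b then a else b.
have dE : form top (delta w) (delta d) != 0.
  rewrite formC contraction_orthw /d /delta; case: ifP => _.
    by rewrite eqxx (eq_sym b) (nb aV) mulr1 mulr0 addr0 signr_eq0.
  by rewrite eqxx (nb aV) mulr1 mulr0 add0r signr_eq0.
pose t := - form top x0 (delta d) / form top (delta w) (delta d).
pose x v := t * delta w v + x0 v.
have xd : form top x (delta d) = 0.
  by rewrite form_lin_l /t mulfVK // addNr.
have xV : {in verts bot, x =1 y}.
  by move=> v vV; rewrite /x /delta /x0 nb // nw //=; ring.
have xb : x b = k * x a.
  by rewrite (xV a aV) /x /x0 eqxx /delta (eq_sym b) wb /=; ring.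
have f z : z b = k * z a -> form top x z = form bot y z.
  by move=> zb; rewrite contraction_form //; apply: form_ext.
have xw : form top x (delta w) = 0.
  by rewrite contraction_orthw xb /k /sw /sb; case: (esgn top b); case: (esgn top w);
    rewrite /= ?expr1 ?expr0; ring.
have -> : form bot y y = form top x x.
  by rewrite f //; apply: form_ext => // v vV; rewrite xV.
apply: wt'; first by exists u; rewrite ?xV ?sub.
move=> v vT mv.
have vxb : ~~ marked top b -> form top x (delta b) = 0.
  by move=> mb; move: xd; rewrite /d (negbTE mb).
have [->|vw] := eqVneq v w; first exact: xw.
have [vb|vb] := eqVneq v b; first by rewrite vb vxb // -vb.
have vV : v \in verts bot.
  by move: vT; rewrite (perm_mem (contraction_V R)) !inE (negbTE vw) (negbTE vb).
have [va|va] := eqVneq v a; last first.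
  rewrite f; first by apply: oy => //; rewrite (contraction_m R).
  by rewrite /delta (eq_sym a) (eq_sym b) (negbTE va) (negbTE vb) mulr0.
rewrite va; move: mv; rewrite va => ma.
case mb: (marked top b); first by move: xd; rewrite /d mb.
have : form top x (fun v => k * delta b v + delta a v) = 0.
  rewrite f; last by rewrite /delta !eqxx (nb aV) (eq_sym b) (nb aV) /=; ring.
  rewrite -(form_ext (x := y) (y := delta a) wfb) //.
    by apply: oy => //; rewrite (contraction_ma R) -/a (negbTE ma) mb.
  by move=> z zV; rewrite /delta nb //=; ring.
by rewrite form_lin vxb ?mb // mulr0 add0r.
Qed.

Lemma contraction_move G H : realize G bot -> realize H top -> neumann_move G H.
Proof.
move=> GB HT; apply: (moveC_label GB HT (contraction_V R) _ aV) => //.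
- by case: wft.
- move=> x y xV yV xa ya; rewrite /adjT (contraction_rt R) !(contraction_par R) // -/a.
  have h z t : t \in verts bot -> t != a ->
      ((if par top z == b then a else par top z) == t) = (par top z == t).
    move=> tV ta; case: (eqVneq (par top z) b) => // ->.
    by rewrite (eq_sym b) (nb tV) (eq_sym a) (negbTE ta).
  by rewrite !h.
- move=> x xV xa; rewrite /adjT (contraction_rt R) !(contraction_par R) // -/a.
  rewrite (contraction_parb R) (eq_sym w) (nw xV) andbF /=.
  have -> : (a != rt bot) && ((if par top a == b then a else par top a) == x) =
            (a != rt bot) && (par top a == x).
    case: (eqVneq a (rt bot)) => //= ar; rewrite ifF //; apply/negbTE/eqP=> h.
    have := wf_rk wft aT; rewrite (contraction_rt R) ar h => /(_ isT) h'.
    by have := ltn_trans (ltn_trans h' rka) rkw; rewrite ltnn.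
  rewrite -orbA -andb_orr; congr (_ || (_ && _)).
  by case: (eqVneq (par top x) b) => [->|]; rewrite ?eqxx ?orbT ?orbF.
- move=> x xT; rewrite /adjT (contraction_wr R) /= -/a (eq_sym a); congr (_ || _).
  apply/idP/eqP => [/andP[xr h]|->]; first by apply: (contraction_uniq R);
    rewrite /child xT xr h.
  by rewrite (contraction_br R) (contraction_parb R) eqxx.
- exact: contraction_wtw R.
- exact: contraction_wta R.
- exact: contraction_wt R.
Qed.
End Contraction.

(** * The state of the normalisation *)

Definition pending T v := ~~ marked T v && todo T v.
Definition npend T := count (pending T) (verts T).

(** A pending vertex is one whose chain is still to be normalised.  Finished
    unmarked vertices have weight at most -2 and no pending child; hence the
    parent of a pending vertex is never finished, and its weight may be changed
    freely. *)
Record norm_state T : Prop := NormState {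
  norm_state_wf : wf T;
  norm_state_rt : marked T (rt T);
  norm_state_unary : forall p c c', ~~ marked T p -> child T p c -> child T p c' ->
    c = c';
  norm_state_todo : forall v, v \in verts T -> v != rt T -> pending T v ->
    marked T (par T v) || todo T (par T v);
  norm_state_done : forall v, v \in verts T -> ~~ marked T v -> ~~ todo T v ->
    wt T v <= -2;
  norm_state_wneg : wneg T }.

Lemma pending_nrt T v : norm_state T -> pending T v -> v != rt T.
Proof. by move=> h /andP[mv _]; apply: contraNneq mv => ->; apply: norm_state_rt. Qed.

(** Written additively to avoid subtraction. *)
Lemma count_update (s : seq nat) (P P' : pred nat) v : uniq s -> v \in s ->
  {in s, forall u, u != v -> P u = P' u} ->
  (count P' s + P v = count P s + P' v)%N.
Proof.
move=> us vs E; rewrite !(seq.permP (perm_to_rem vs)) /=.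
have -> : count P' (rem v s) = count P (rem v s).
  apply: eq_in_count => u; rewrite mem_rem_uniq // inE => /andP[uv us'].
  by rewrite E.
by lia.
Qed.

Lemma fresh_label (s : seq nat) : exists w, w \notin s.
Proof.
exists (\max_(v <- s) v).+1; apply/negP=> h.
by have := @leq_bigmax_seq _ _ predT id _ h isT; rewrite ltnn.
Qed.

Lemma tree_reach_up bot top : wf top ->
  (forall G H, realize G bot -> realize H top -> neumann_move G H) ->
    tree_reach bot top.
Proof.
move=> wft m G GB; have [H HT] := rtree_realizable wft.
by exists H => //; apply: reach_step; apply: m.
Qed.

Lemma tree_reach_down bot top : wf bot ->
  (forall G H, realize G bot -> realize H top -> neumann_move G H) ->
    tree_reach top bot.
Proof.
move=> wfb m H HT; have [G GB] := rtree_realizable wfb.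
by exists G => //; apply: reach_step; apply: neumann_move_sym; apply: m.
Qed.

(** * The moves on rooted trees *)

Section BlowUpEdge.
Variables (T : rtree) (v w : nat) (e tdv : bool).
Hypotheses (wfT : wf T) (vV : v \in verts T) (vr : v != rt T) (wN : w \notin verts T).

(** Ranks are doubled to make room for [w] between [v] and its parent.  The
    parameter [tdv] decides whether [v] is pending afterwards. *)
Definition blow_up_edge := RTree (w :: verts T) (rt T)
  (fun x => if x == w then par T v else if x == v then w else par T x)
  (fun x => if x == w then (rk T v).*2.-1 else (rk T x).*2)
  (fun x => if x == w then (-1) ^+ e else
     wt T x + (if (x == v) || (x == par T v) then (-1) ^+ e else 0))
  (fun x => (x != w) && marked T x)
  (fun x => if x == w then true else if x == v then tdv else todo T x)
  (fun x => if x == w then false else if x == v then ~~ (e (+) esgn T v) else esgn T x).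

Let nw u : u \in verts T -> (u == w) = false.
Proof. by move=> uV; apply: contraNF wN => /eqP <-. Qed.
Let rV : rt T \in verts T. Proof. by case: wfT. Qed.
Let pV := wf_parV wfT vV vr.
Let rk0 := wf_rk wfT vV vr.

Lemma blow_up_edge_wf : wf blow_up_edge.
Proof.
split=> /=; rewrite ?wN ?inE ?rV ?orbT //; first by case: wfT.
move=> u; rewrite !inE; case: eqVneq => [->|uw] /=.
  by move=> _ _; rewrite pV orbT nw //; split=> //; move: rk0; lia.
move=> uV ur; case: (eqVneq u v) => [->|uv]; first by rewrite !eqxx; split=> //;
  move: rk0; lia.
have := wf_parV wfT uV ur => puV; rewrite puV orbT nw //; split=> //.
by have := wf_rk wfT uV ur; lia.
Qed.

Lemma blow_up_edge_rel : edge_blowup e T blow_up_edge w v.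
Proof.
have sg2 : (e (+) ~~ (e (+) esgn T v)) = ~~ esgn T v by case: (e); case: (esgn T v).
split=> //=; rewrite ?eqxx ?nw //.
- by move=> u uV; rewrite nw //; case: eqVneq => [->|].
- by move=> u uV; rewrite nw.
- by move=> u uV; rewrite nw.
- by move=> u uV; rewrite nw //; case: eqVneq => [->|//]; rewrite sg2 addbF negbK.
Qed.

Lemma blow_up_edge_reach : tree_reach T blow_up_edge.
Proof.
apply: tree_reach_up blow_up_edge_wf _ => G H; exact: edge_blowup_move wfT
  blow_up_edge_wf blow_up_edge_rel.
Qed.

Lemma blow_up_edge_norm_state : norm_state T -> marked T (par T v) || todo T (par T
  v) ->
  [|| marked T v, tdv | (wt T v + (-1) ^+ e <= -2)] ->
  (marked T v || tdv \/ forall c, child T v c -> ~~ pending T c) ->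
    norm_state blow_up_edge.
Proof.
move=> iT mp wv cv; split; rewrite ?nw //.
- exact: blow_up_edge_wf.
- by rewrite /= nw // norm_state_rt.
- have chE p c : child blow_up_edge p c ->
    [\/ [/\ p = par T v & c = w], p = w /\ c = v | [/\ p != w, c != v, c != w &
      child T p c]].
    rewrite /child /= inE; case: eqVneq => [->|cw] /=.
      by case/andP=> _ /eqP <-; constructor 1.
    case/and3P=> cV cr; case: (eqVneq c v) cr => [-> _ /eqP <-|cv' cr cp];
      [by constructor 2|].
    constructor 3; rewrite cV cr cp; split=> //.
    by apply: contraNneq wN => <-; rewrite -(eqP cp); exact: wf_parV.
  move=> p c c' mp' /chE h /chE; case: h => [[pE ->]|[pE ->]|[pw cv' cw h]].
  + case=> [[_ ->]//|[pE' _]|[_ c'v _ h']]; first by move: pV;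
    rewrite -pE pE' (negbTE wN).
    case/negP: c'v; apply/eqP; apply: (norm_state_unary iT (p := p)) => //.
      by move: mp'; rewrite /= pE nw.
    by rewrite /child vV vr pE eqxx.
  + by case=> [[pE' _]|[_ ->//]|[/eqP//]]; move: pV; rewrite -pE' pE (negbTE wN).
  + case=> [[pE ->]|[pE _]|[_ _ _ h']]; last 1 first.
    * by apply: (norm_state_unary iT (p := p)) => //; move: mp'; rewrite /= pw.
    * case/negP: cv'; apply/eqP; apply: (norm_state_unary iT (p := p)) => //.
        by move: mp'; rewrite /= pE nw.
      by rewrite /child vV vr pE eqxx.
    * by rewrite pE eqxx in pw.
- move=> u; rewrite /pending !inE /=; case: eqVneq => [->|uw] /=.
    by move=> _ _ _; rewrite nw //= (negbTE (wf_par_neq wfT vV vr)).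
  move=> uV ur; case: (eqVneq u v) => [->|uv]; first by rewrite eqxx orbT.
  move=> pu; have puV := wf_parV wfT uV ur; rewrite nw //=.
  have := norm_state_todo iT uV ur pu; case: eqVneq => [pv|//].
  rewrite pv => h; case: cv => [//|cv]; have := cv u.
  by rewrite /child uV ur pv eqxx => /(_ isT); rewrite /pending pu.
- move=> u; rewrite !inE /=; case: eqVneq => [->//|uw] /=.
  move=> uV mu; case: (eqVneq u v) => [uE|uv] /=.
    by move=> tv; move: wv; rewrite -uE (negbTE mu) (negbTE tv).
  case: eqVneq => [uE|_] tu; last by rewrite addr0; apply: norm_state_done.
  by move: mp; rewrite -uE (negbTE mu) (negbTE tu).
- exact: (edge_blowup_wneg_up wfT blow_up_edge_wf blow_up_edge_rel) (norm_state_wneg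
  iT).
Qed.

Lemma blow_up_edge_npend : (npend blow_up_edge + pending T v = (npend T).+1 + (~~
  marked T v && tdv))%N.
Proof.
have uV : uniq (verts T) by case: wfT.
rewrite {1}/npend /= {1}/pending /= eqxx /= add1n addSn addSn; congr _.+1.
rewrite [RHS](_ : _ = (count (pending T) (verts T) + pending blow_up_edge v)%N).
  apply: count_update => // u uV' uv; rewrite /pending /= nw // (negbTE uv).
  by [].
by rewrite /pending /= nw // eqxx.
Qed.
End BlowUpEdge.

Section BlowUpVertex.
Variables (T : rtree) (u w : nat) (e : bool).
Hypotheses (wfT : wf T) (uV : u \in verts T) (wN : w \notin verts T).

Definition blow_up_vertex := RTree (w :: verts T) (rt T)
  (fun x => if x == w then u else par T x)
  (fun x => if x == w then (rk T u).+1 else rk T x)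
  (fun x => if x == w then (-1) ^+ e else
     wt T x + (if x == u then (-1) ^+ e else 0))
  (fun x => (x != w) && marked T x)
  (fun x => (x == w) || todo T x)
  (fun x => if x == w then false else esgn T x).

Let nw x : x \in verts T -> (x == w) = false.
Proof. by move=> xV; apply: contraNF wN => /eqP <-. Qed.
Let rV : rt T \in verts T. Proof. by case: wfT. Qed.

Lemma blow_up_vertex_wf : wf blow_up_vertex.
Proof.
split=> /=; rewrite ?wN ?inE ?rV ?orbT //; first by case: wfT.
move=> x; rewrite !inE; case: eqVneq => [->|xw] /=.
  by move=> _ _; rewrite uV orbT nw.
move=> xV xr; have := wf_parV wfT xV xr => pxV; rewrite pxV orbT nw //; split=> //.
exact: wf_rk.
Qed.

Lemma blow_up_vertex_rel : vertex_blowup e T blow_up_vertex w u.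
Proof. by split=> //=; rewrite ?eqxx // => x xV; rewrite nw. Qed.

Lemma blow_up_vertex_reach : tree_reach T blow_up_vertex.
Proof.
apply: tree_reach_up blow_up_vertex_wf _ => G H GB HT;
  exact: (vertex_blowup_move wfT blow_up_vertex_wf blow_up_vertex_rel GB HT).
Qed.

Lemma blow_up_vertex_norm_state : norm_state T -> pending T u ->
  (forall c, ~~ child T u c) -> norm_state blow_up_vertex.
Proof.
move=> iT pu cu; split.
- exact: blow_up_vertex_wf.
- by rewrite /= nw // norm_state_rt.
- have chE p c : child blow_up_vertex p c -> p = u /\ c = w \/ p != w /\ child T p c.
    rewrite /child /= inE; case: eqVneq => [->|cw] /=.
      by case/andP=> _ /eqP <-; left.
    case/and3P=> cV cr cp; right; rewrite cV cr cp; split=> //.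
    by apply: contraNneq wN => <-; rewrite -(eqP cp); exact: wf_parV.
  move=> p c c' mp /chE[[pE ->]|[pw h]] /chE[[pE' ->]|[_ h']] //.
  + by rewrite pE (negbTE (cu c')) in h'.
  + by rewrite pE' (negbTE (cu c)) in h.
  + by apply: (norm_state_unary iT) h h'; move: mp; rewrite /= pw.
- move=> x; rewrite /pending !inE /=; case: eqVneq => [->|xw] /=.
    by move=> _ _ _; case/andP: pu => _ ->; rewrite !orbT.
  move=> xV xr px; rewrite nw ?(wf_parV wfT) //=; exact: norm_state_todo.
- move=> x; rewrite !inE /=; case: eqVneq => [->//|xw] /=.
  move=> xV mx tx; case: eqVneq => [xE|_]; last by rewrite addr0;
    apply: norm_state_done.
  by move: pu; rewrite -xE /pending (negbTE tx) andbF.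
- exact: (vertex_blowup_wneg_up wfT blow_up_vertex_wf blow_up_vertex_rel)
  (norm_state_wneg iT).
Qed.

Lemma blow_up_vertex_npend : npend blow_up_vertex = (npend T).+1.
Proof.
rewrite /npend /= {1}/pending /= eqxx /= add1n; congr _.+1.
by apply: eq_in_count => x xV; rewrite /pending /= nw.
Qed.
End BlowUpVertex.

Section BlowDownEdge.
Variables (T : rtree) (w v : nat) (e : bool).
Hypotheses (iT : norm_state T) (pw : pending T w) (wV : w \in verts T) (wv : child T
  w v).
Hypothesis (we : wt T w = (-1) ^+ e).

(** The child [v] is made pending because its weight changes. *)
Definition blow_down_edge := RTree (rem w (verts T)) (rt T)
  (fun x => if x == v then par T w else par T x) (rk T)
  (fun x => wt T x - (if (x == v) || (x == par T w) then (-1) ^+ e else 0))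
  (marked T) (fun x => (x == v) || todo T x)
  (fun x => if x == v then ~~ (e (+) esgn T v (+) esgn T w) else esgn T x).

Let wfT := norm_state_wf iT.
Let uT : uniq (verts T). Proof. by case: wfT. Qed.
Let wr : w != rt T := pending_nrt iT pw.
Let mw : ~~ marked T w. Proof. by case/andP: pw. Qed.
Let vV : v \in verts T. Proof. by case/and3P: wv. Qed.
Let vr : v != rt T. Proof. by case/and3P: wv. Qed.
Let pvw : par T v = w. Proof. by case/and3P: wv => _ _ /eqP. Qed.
Let vw : (v == w) = false.
Proof. by apply/negbTE; rewrite eq_sym -[X in X != _]pvw wf_par_neq. Qed.
Let chw c : c \in verts T -> c != rt T -> c != v -> (par T c == w) = false.
Proof.
move=> cV cr; apply: contraNF => h; apply/eqP.
by apply: (norm_state_unary iT mw) wv; rewrite /child cV cr h.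
Qed.
Let memr u : (u \in rem w (verts T)) = (u != w) && (u \in verts T).
Proof. by rewrite mem_rem_uniq. Qed.

Lemma blow_down_edge_wf : wf blow_down_edge.
Proof.
split=> /=; first exact: rem_uniq.
  by rewrite memr eq_sym wr; case: wfT.
move=> u; rewrite memr => /andP[uw uV] ur; rewrite memr; case: (eqVneq u v) => [->|uv].
  rewrite wf_par_neq // wf_parV //; split=> //.
  by apply: ltn_trans (wf_rk wfT wV wr) _; rewrite -{1}pvw wf_rk.
by rewrite chw // wf_parV //; split=> //; apply: wf_rk.
Qed.

Lemma blow_down_edge_rel : edge_blowup e blow_down_edge T w v.
Proof.
split=> //=.
- exact: perm_to_rem.
- by rewrite memr vw vV.
- by move=> u _; rewrite subrK.
Qed.

Lemma blow_down_edge_reach : tree_reach T blow_down_edge.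
Proof.
apply: tree_reach_down blow_down_edge_wf _ => G H;
  exact: edge_blowup_move blow_down_edge_wf wfT blow_down_edge_rel.
Qed.

Lemma blow_down_edge_norm_state : norm_state blow_down_edge.
Proof.
have pw' := norm_state_todo iT wV wr pw; split.
- exact: blow_down_edge_wf.
- exact: norm_state_rt iT.
- have chE p c : child blow_down_edge p c -> p = par T w /\ c = v \/ [/\
  c != w, c != v & child T p c].
    rewrite /child /= memr; case: (eqVneq c v) => [->|cv] /and3P[].
      by move=> _ _ /eqP <-; left.
    by move=> /andP[cw cV] cr cp; right; rewrite cV cr cp.
  have cw : child T (par T w) w by rewrite /child wV wr eqxx.
  move=> p c c' mp /chE[[pE ->]|[c1 c2 h]] /chE[[pE' ->]|[c1' c2' h']] //.
  + by case/eqP: c1'; apply: (norm_state_unary iT mp) h' _; rewrite pE.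
  + by case/eqP: c1; apply: (norm_state_unary iT mp) h _; rewrite pE'.
  + exact: (norm_state_unary iT mp) h h'.
- move=> u; rewrite /pending memr /= => /andP[uw uV] ur.
  case: (eqVneq u v) => [->|uv] /= pu; first by case/orP: pw' => ->; rewrite ?orbT.
  by case/orP: (norm_state_todo iT uV ur pu) => ->; rewrite ?orbT.
- move=> u; rewrite memr negb_or /= => /andP[uw uV] mu /andP[uv tu].
  rewrite (negbTE uv); case: eqVneq => [uE|_]; last by rewrite subr0;
    apply: norm_state_done.
  by move: pw'; rewrite -uE (negbTE mu) (negbTE tu).
- exact: (edge_blowup_wneg_down blow_down_edge_wf wfT blow_down_edge_rel)
  (norm_state_wneg iT).
Qed.

Lemma blow_down_edge_npend : (npend blow_down_edge + 1 + pending T v = npend T + ~~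
  marked T v)%N.
Proof.
rewrite {2}/npend (seq.permP (perm_to_rem wV)) /= pw /npend /=.
have := @count_update (rem w (verts T)) (pending T) (pending blow_down_edge) v.
rewrite rem_uniq // memr vw vV => /(_ isT isT) h.
have -> : ~~ marked T v = pending blow_down_edge v by rewrite /pending /= eqxx andbT.
rewrite addnAC addn1 add1n addSn; congr _.+1; apply: h.
by move=> u _ uv; rewrite /pending /= (negbTE uv).
Qed.

Lemma blow_down_edge_size : (size (verts blow_down_edge)).+1 = size (verts T).
Proof. by rewrite (perm_size (perm_to_rem wV)). Qed.
End BlowDownEdge.

Section BlowDownVertex.
Variables (T : rtree) (w : nat) (e : bool).
Hypotheses (iT : norm_state T) (pw : pending T w) (wV : w \in verts T).
Hypotheses (leaf : forall c, ~~ child T w c) (we : wt T w = (-1) ^+ e).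

Definition blow_down_vertex := RTree (rem w (verts T)) (rt T) (par T) (rk T)
  (fun x => wt T x - (if x == par T w then (-1) ^+ e else 0))
  (marked T) (todo T) (esgn T).

Let wfT := norm_state_wf iT.
Let uT : uniq (verts T). Proof. by case: wfT. Qed.
Let wr : w != rt T := pending_nrt iT pw.
Let mw : ~~ marked T w. Proof. by case/andP: pw. Qed.
Let chw c : c \in verts T -> c != rt T -> (par T c == w) = false.
Proof. by move=> cV cr; have := leaf c; rewrite /child cV cr => /negbTE. Qed.
Let memr u : (u \in rem w (verts T)) = (u != w) && (u \in verts T).
Proof. by rewrite mem_rem_uniq. Qed.

Lemma blow_down_vertex_wf : wf blow_down_vertex.
Proof.
split=> /=; first exact: rem_uniq.
  by rewrite memr eq_sym wr; case: wfT.
move=> u; rewrite memr => /andP[uw uV] ur; rewrite memr.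
by rewrite chw // wf_parV //; split=> //; apply: wf_rk.
Qed.

Lemma blow_down_vertex_rel : vertex_blowup e blow_down_vertex T w (par T w).
Proof.
split=> //=.
- exact: perm_to_rem.
- by rewrite memr wf_par_neq // wf_parV.
- by move=> u _; rewrite subrK.
Qed.

Lemma blow_down_vertex_reach : tree_reach T blow_down_vertex.
Proof.
apply: tree_reach_down blow_down_vertex_wf _ => G H GB HT;
  exact: (vertex_blowup_move blow_down_vertex_wf wfT blow_down_vertex_rel GB HT).
Qed.

Lemma blow_down_vertex_norm_state : norm_state blow_down_vertex.
Proof.
have pw' := norm_state_todo iT wV wr pw; split.
- exact: blow_down_vertex_wf.
- exact: norm_state_rt iT.
- move=> p c c' mp; rewrite /child /= !memr => /and3P[/andP[_ h1] h2 h3]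
  /and3P[/andP[_ h1'] h2' h3'].
  by apply: (norm_state_unary iT mp); apply/and3P.
- by move=> u; rewrite memr /= => /andP[uw uV] ur; exact: (norm_state_todo iT uV ur).
- move=> u; rewrite memr /= => /andP[uw uV] mu tu.
  case: eqVneq => [uE|_]; last by rewrite subr0; apply: norm_state_done.
  by move: pw'; rewrite -uE (negbTE mu) (negbTE tu).
- exact: (vertex_blowup_wneg_down blow_down_vertex_wf wfT blow_down_vertex_rel)
  (norm_state_wneg iT).
Qed.

Lemma blow_down_vertex_npend : (npend blow_down_vertex).+1 = npend T.
Proof. by rewrite {2}/npend (seq.permP (perm_to_rem wV)) /= pw. Qed.
End BlowDownVertex.

Section Contract.
Variables (T : rtree) (w b : nat).
Hypotheses (iT : norm_state T) (pw : pending T w) (wV : w \in verts T) (wb : child T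
  w b).
Hypotheses (w0 : wt T w = 0) (mab : ~~ (marked T (par T w) && marked T b)).
Let a := par T w.

Definition contract := RTree (rem b (rem w (verts T))) (rt T)
  (fun x => if par T x == b then a else par T x) (rk T)
  (fun x => if x == a then wt T a + wt T b else wt T x)
  (fun x => if x == a then marked T a || marked T b else marked T x) (todo T)
  (fun x => if par T x == b then ~~ (esgn T w (+) esgn T b (+) esgn T x) else esgn T x).

Let wfT := norm_state_wf iT.
Let uT : uniq (verts T). Proof. by case: wfT. Qed.
Let wr : w != rt T := pending_nrt iT pw.
Let mw : ~~ marked T w. Proof. by case/andP: pw. Qed.
Let bV : b \in verts T. Proof. by case/and3P: wb. Qed.
Let br : b != rt T. Proof. by case/and3P: wb. Qed.
Let pbw : par T b = w. Proof. by case/and3P: wb => _ _ /eqP. Qed.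
Let aV : a \in verts T. Proof. exact: wf_parV. Qed.
Let rka : (rk T a < rk T w)%N. Proof. exact: wf_rk. Qed.
Let rkb : (rk T w < rk T b)%N. Proof. by rewrite -[in X in (X < _)%N]pbw;
  apply: wf_rk. Qed.
Let bw : (b == w) = false.
Proof. by apply/negbTE; rewrite eq_sym -[X in X != _]pbw wf_par_neq. Qed.
Let aw : (a == w) = false. Proof. by apply/negbTE; rewrite wf_par_neq. Qed.
Let ab : (a == b) = false.
Proof. by apply/eqP=> h; have := ltn_trans rka rkb; rewrite h ltnn. Qed.
Let chw c : c \in verts T -> c != rt T -> c != b -> (par T c == w) = false.
Proof.
move=> cV cr; apply: contraNF => h; apply/eqP.
by apply: (norm_state_unary iT mw) wb; rewrite /child cV cr h.
Qed.
Let memr u : (u \in rem b (rem w (verts T))) = [&& u != b, u != w & u \in verts T].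
Proof. by rewrite mem_rem_uniq ?rem_uniq // inE mem_rem_uniq. Qed.
Let permT : perm_eq (verts T) [:: w, b & rem b (rem w (verts T))].
Proof.
apply: perm_trans (perm_to_rem wV) _; rewrite perm_cons; apply: perm_to_rem.
by rewrite mem_rem_uniq // !inE bw.
Qed.
Let pa' : marked T a || todo T a. Proof. exact: norm_state_todo. Qed.

Lemma contract_wf : wf contract.
Proof.
split=> /=; first by rewrite !rem_uniq.
  by rewrite memr ![rt T == _]eq_sym wr br; case: wfT.
move=> u; rewrite memr => /and3P[ub uw uV] ur; rewrite memr.
case: (eqVneq (par T u) b) => [pub|pub].
  rewrite ab aw aV; split=> //; apply: ltn_trans rka (ltn_trans rkb _).
  by rewrite -pub wf_rk.
by rewrite pub chw // wf_parV //; split=> //; apply: wf_rk.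
Qed.

Lemma contract_rel : contraction contract T w b.
Proof.
split=> //=; rewrite -/a ?eqxx //.
- by move=> c h; apply: (norm_state_unary iT mw).
- by move=> u _ /negbTE ->.
- by move=> u _ /negbTE ->.
Qed.

Lemma contract_reach : tree_reach T contract.
Proof.
apply: tree_reach_down contract_wf _ => G H GB HT;
  exact: (contraction_move wfT contract_rel GB HT).
Qed.

Lemma contract_norm_state : norm_state contract.
Proof.
split.
- exact: contract_wf.
- by rewrite /=; case: eqVneq => [<-|_]; rewrite norm_state_rt.
- have chE p c : child contract p c -> c != w /\ (child T p c \/ p = a /\ child T b c).
    rewrite /child /= memr => /and3P[/and3P[cb cw cV] cr].
    case: (eqVneq (par T c) b) => [pc /eqP <-|pc pcp]; split=> //.
      by right; rewrite cV cr.
    by left; rewrite cV cr.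
  have cw : child T a w by rewrite /child wV wr eqxx.
  have una c : ~~ marked T a -> child T a c -> c = w by move=> ma h;
    apply: (norm_state_unary iT ma).
  move=> p c c'; rewrite /=; case: (eqVneq p a) => [->|pa] mp; last first.
    move=> /chE[_ [h|[/eqP]]]; last by rewrite (negbTE pa).
    move=> /chE[_ [h'|[/eqP]]]; last by rewrite (negbTE pa).
    exact: (norm_state_unary iT mp) h h'.
  move: mp; rewrite negb_or => /andP[ma mb].
  move=> /chE[cNw [/(una _ ma)/eqP|[_ h]]]; first by rewrite (negbTE cNw).
  move=> /chE[cNw' [/(una _ ma)/eqP|[_ h']]]; first by rewrite (negbTE cNw').
  exact: (norm_state_unary iT mb) h h'.
- move=> u; rewrite memr /pending /= => /and3P[ub uw uV] ur pu.
  case: (eqVneq (par T u) b) => [pub|pub].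
    by rewrite eqxx; case/orP: pa' => ->; rewrite ?orbT.
  have pu' : pending T u.
    by move: pu; rewrite /pending; case: (eqVneq u a) => [->|//];
      rewrite negb_or -andbA => /and3P[-> _ ->].
  have := norm_state_todo iT uV ur pu'.
  by case: (eqVneq (par T u) a) => [->|_ //] /orP[] ->; rewrite ?orbT.
- move=> u; rewrite memr /= => /and3P[ub uw uV]; case: eqVneq => [->|ua];
  last exact: norm_state_done.
  by rewrite negb_or => /andP[ma _] ta; move: pa'; rewrite (negbTE ma) (negbTE ta).
- exact: (contraction_wneg contract_wf wfT contract_rel mab) (norm_state_wneg iT).
Qed.

Lemma contract_npend : (npend contract + 1 + pending T b <= npend T)%N.
Proof.
rewrite {2}/npend (seq.permP permT) /= pw.
rewrite addnAC addn1 add1n ltnS addnC leq_add2l.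
apply: sub_count => u; rewrite /pending /=; case: eqVneq => [->|//].
by rewrite negb_or => /andP[/andP[-> _] ->].
Qed.
End Contract.

Section MarkDone.
Variables (T : rtree) (v : nat).
Hypotheses (iT : norm_state T) (pv : pending T v) (vV : v \in verts T) (v2 : wt T v
  <= -2).
Hypothesis chv : forall c, child T v c -> ~~ pending T c.

Definition mark_done := RTree (verts T) (rt T) (par T) (rk T) (wt T) (marked T)
  (fun x => (x != v) && todo T x) (esgn T).

Lemma mark_done_reach : tree_reach T mark_done.
Proof. by move=> G GT; exists G => //; apply: reach_refl. Qed.

Lemma mark_done_norm_state : norm_state mark_done.
Proof.
split; try by case: iT.
- move=> u uV ur; rewrite /pending /= => /andP[mu /andP[uv tu]].
  have pu : pending T u by rewrite /pending mu.
  have := norm_state_todo iT uV ur pu; case: eqVneq => [puv|//].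
  by move=> _; have := chv (c := u); rewrite /child uV ur puv eqxx pu => /(_ isT).
- move=> u uV mu; rewrite /= negb_and negbK => /orP[/eqP ->//|].
  exact: norm_state_done.
Qed.

Lemma mark_done_npend : (npend mark_done).+1 = npend T.
Proof.
have := @count_update (verts T) (pending T) (pending mark_done) v.
have -> : pending mark_done v = false by rewrite /pending /= eqxx andbF.
rewrite pv addn0 addn1 => h; rewrite /npend h //; first by case: (norm_state_wf iT).
by move=> u _ uv; rewrite /pending /= uv.
Qed.
End MarkDone.

(** * Normalising the chains *)

Lemma child_neq T v w : norm_state T -> child T v w -> w != v.
Proof. by move=> iT /and3P[wV wr /eqP <-]; rewrite eq_sym (wf_par_neq (norm_state_wf
  iT)). Qed.

(** With p the parent of [v], the chain p, m, -1 is turned, by m blow-ups of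
    the edge below [v], into p, 0, -1, -2, ..., -2 (the last weight -2 is that
    of [d]), and contracting the 0 merges the -1 into p.  In total [v] and one
    vertex of weight -1 disappear from the pending ones. *)
Lemma absorb_pos (m : nat) T v d : norm_state T -> v \in verts T -> pending T v ->
  wt T v = m -> child T v d -> pending T d -> wt T d = -1 ->
  (forall c, child T d c -> ~~ pending T c) ->
  exists T', [/\ norm_state T', tree_reach T T' & (npend T' + 2 <= npend T)%N].
Proof.
elim: m T v d => [|m IH] T v d iT vV pv wv vd pd wd cd.
  have mab : ~~ (marked T (par T v) && marked T d).
    by rewrite negb_and; case/andP: pd => ->; rewrite orbT.
  exists (contract T v d); split; first exact: contract_norm_state.
    exact: contract_reach.
  by have := contract_npend iT pv vV vd; rewrite pd -addnA.
have [w wN] := fresh_label (verts T).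
have /and3P[dV dr /eqP pdv] := vd.
have wfT := norm_state_wf iT.
have dv := child_neq iT vd.
have vw : (v == w) = false by apply: contraNF wN => /eqP <-.
have dw : (d == w) = false by apply: contraNF wN => /eqP <-.
have wr : w != rt T by apply: contraNneq wN => ->; case: wfT.
pose T1 := blow_up_edge T d w true false.
have iT1 : norm_state T1.
  apply: blow_up_edge_norm_state => //; last by right.
    by rewrite pdv; case/andP: pv => _ ->; rewrite orbT.
  by rewrite wd !orbT.
have n1 : npend T1 = npend T.
  have := blow_up_edge_npend true false wfT dV wN; rewrite -/T1 pd andbF addn0 addn1.
  by case.
have [|||||||T' [iT' r' n']] := IH T1 v w iT1.
- by rewrite inE vV orbT.
- by move: pv; rewrite /pending /= vw /= (eq_sym v) (negbTE dv).
- by rewrite /= vw pdv eqxx orbT wv -addn1 PoszD addrK.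
- by rewrite /child /= inE !eqxx wr pdv eqxx.
- by rewrite /pending /= eqxx.
- by rewrite /= eqxx.
- move=> c; rewrite /child /= inE /pending; case: (eqVneq c w) => [->|cw] /=.
    by rewrite pdv vw andbF.
  case/and3P=> cV cr; case: (eqVneq c d) => [->|cd'] /=; first by rewrite dw andbF.
  by move/eqP=> h; have := wf_parV wfT cV cr; rewrite h (negbTE wN).
exists T'; split=> //; last by rewrite -n1.
exact: tree_reach_trans (blow_up_edge_reach true false wfT dV dr wN) r'.
Qed.

(** The coordinate vector of [v] is orthogonal to all unmarked vertices, itself
    included, and isotropic. *)
Lemma zero_isolated T v : norm_state T -> v \in verts T -> pending T v -> wt T v = 0 ->
  marked T (par T v) -> (forall c, child T v c -> marked T c) -> False.
Proof.
move=> iT vV pv w0 mp mc; have mv : ~~ marked T v by case/andP: pv.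
have o : orth T (delta v).
  move=> u uV mu; rewrite /form big1_seq // => t /= tV.
  rewrite /term /delta.
  have -> : (wt T t)%:~R * (t == v)%:R * (t == u)%:R = 0 :> rat.
    by case: (eqVneq t v) => [->|_] /=; rewrite ?w0 ?mulr0 ?mul0r.
  case: eqVneq => tr; first by rewrite addr0.
  have -> : (t == v)%:R * (par T t == u)%:R = 0 :> rat.
    case: (eqVneq t v) => [->|_] /=; last by rewrite mul0r.
    by case: eqVneq => [h|_] /=; rewrite ?mulr0 //; move: mu; rewrite -h mp.
  have -> : (par T t == v)%:R * (t == u)%:R = 0 :> rat.
    case: (eqVneq t u) => [h|_] /=; last by rewrite mulr0.
    case: eqVneq => [h'|_] /=; rewrite ?mul0r //; move: mu; rewrite -h mc //.
    by rewrite /child tV tr h' eqxx.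
  by rewrite addr0 mulr0 addr0.
have := norm_state_wneg iT _ o; rewrite (o v vV mv) ltxx => h.
by apply/notF/h; exists v => //; rewrite /delta eqxx oner_neq0.
Qed.

(** A leaf of weight 0 allows any weight at its neighbour: blowing up the edge
    between them with sign e makes the leaf have weight e, and blowing this
    leaf down leaves the new vertex as a leaf of weight 0, the neighbour
    having changed by e. *)
Lemma clear_leaf_parent (n : nat) T v : norm_state T -> v \in verts T -> pending T v ->
  wt T v = 0 -> (forall c, ~~ child T v c) -> pending T (par T v) ->
  `|wt T (par T v)|%N = n ->
  exists T' v', [/\ norm_state T', tree_reach T T', (npend T' <= npend T)%N &
    [/\ v' \in verts T', pending T' v', wt T' v' = 0, pending T' (par T' v') &
        wt T' (par T' v') = 0]].
Proof.
elim: n T v => [|n IH] T v iT vV pv w0 leaf pp wp.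
  exists T, v; split=> //; first exact: tree_reach_refl.
  by split=> //; apply/eqP; rewrite -absz_eq0 wp.
have [w wN] := fresh_label (verts T).
have wfT := norm_state_wf iT; have vr := pending_nrt iT pv.
have pV := wf_parV wfT vV vr.
have vw : (v == w) = false by apply: contraNF wN => /eqP <-.
have pw : (par T v == w) = false by apply: contraNF wN => /eqP <-.
have pv' : (par T v == v) = false by apply/negbTE/wf_par_neq.
have wr : w != rt T by apply: contraNneq wN => ->; case: wfT.
(* The sign that brings the weight of the parent closer to 0. *)
have [e ee] : exists e : bool, `|(wt T (par T v) + (-1) ^+ e)%R|%N = n.
  case: (leP 0 (wt T (par T v))) => h; [exists true|exists false];
    rewrite /= ?expr1 ?expr0; lia.
pose T1 := blow_up_edge T v w e true.
have iT1 : norm_state T1.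
  apply: blow_up_edge_norm_state => //; last by left; rewrite orbT.
    by case/andP: pp => _ ->; rewrite orbT.
  by rewrite orbT.
have n1 : npend T1 = (npend T).+1.
  have := blow_up_edge_npend e true wfT vV wN; rewrite -/T1 pv andbT.
  by case/andP: pv => -> _; rewrite !addn1; case.
have vV1 : v \in verts T1 by rewrite inE vV orbT.
have pv1 : pending T1 v by move: pv; rewrite /pending /= vw eqxx => /andP[->].
have leaf1 c : ~~ child T1 v c.
  rewrite /child /= inE; case: (eqVneq c w) => [->|cw] /=; first by rewrite pv' andbF.
  case: (eqVneq c v) => [->|cv]; first by rewrite (eq_sym w) vw !andbF.
  exact: leaf.
have we1 : wt T1 v = (-1) ^+ e by rewrite /= vw eqxx w0 add0r.
pose T2 := blow_down_vertex T1 v e.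
have iT2 : norm_state T2 by exact: blow_down_vertex_norm_state.
have n2 : npend T2 = npend T by have := blow_down_vertex_npend e pv1 vV1;
  rewrite -/T2 n1 => -[].
have par1 : par T1 v = w by rewrite /= vw eqxx.
have parw : par T1 w = par T v by rewrite /= eqxx.
have u1 : uniq (verts T1) by case: (norm_state_wf iT1).
have memT2 u : (u \in verts T2) = (u != v) && ((u == w) || (u \in verts T)).
  by rewrite (mem_rem_uniq v u1) !inE.
have [||||||T' [v' [iT' r' n' h']]] := IH T2 w iT2.
- by rewrite memT2 eq_sym vw eqxx.
- by rewrite /pending /= eqxx.
- by rewrite /T2 /blow_down_vertex [LHS]/= -/T1 vw !eqxx subrr.
- move=> c; rewrite /child memT2 /=; case: (eqVneq c v) => //= cv.
  case: (eqVneq c w) => [->|cw] /=; first by rewrite pw andbF.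
  apply/negP=> /and3P[cV cr /eqP h]; have := wf_parV wfT cV cr.
  by rewrite h (negbTE wN).
- by move: pp; rewrite /pending /= eqxx pw pv'.
- by rewrite /= eqxx pw vw !eqxx pv' pw subr0.
exists T', v'; split=> //; last by rewrite -n2.
apply: tree_reach_trans (blow_up_edge_reach e true wfT vV vr wN) _.
by apply: tree_reach_trans r'; apply: blow_down_vertex_reach.
Qed.

Lemma child_or_leaf T v : (exists c, child T v c) \/ (forall c, ~~ child T v c).
Proof.
case h : (has (child T v) (verts T)); [left|right].
  by move/hasP: h => [c _ hc]; exists c.
move=> c; apply: contraFN h => hc; apply/hasP; exists c => //.
by case/and3P: hc.
Qed.

(** One step at a pending vertex whose child, if any, is not pending.  Only
    blowing down a -1 above a finished vertex fails to lower the number of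
    pending vertices, because the child becomes pending in exchange; it lowers
    the size of the tree instead. *)
Lemma reduce_step T v : norm_state T -> v \in verts T -> pending T v ->
  (forall c, child T v c -> ~~ pending T c) ->
  exists T', [/\ norm_state T', tree_reach T T' &
    (npend T' < npend T)%N || (npend T' <= npend T)%N && (size (verts T') < size
      (verts T))%N].
Proof.
move=> iT vV pv cv; have wfT := norm_state_wf iT; have vr := pending_nrt iT pv.
have mp := norm_state_todo iT vV vr pv.
have [w wN] := fresh_label (verts T).
have vw : (v == w) = false by apply: contraNF wN => /eqP <-.
have [v2|v2] := leP (wt T v) (-2).
  exists (mark_done T v); split; first exact: mark_done_norm_state.
    exact: mark_done_reach.
  by rewrite -(mark_done_npend iT pv vV) ltnS leqnn.
have [v1|v1] := eqVneq (wt T v) (-1).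
  have [[c vc]|leaf] := child_or_leaf T v.
    exists (blow_down_edge T v c true); split; first exact: blow_down_edge_norm_state.
      exact: blow_down_edge_reach.
    have := blow_down_edge_npend true iT pv vV vc;
      have := blow_down_edge_size c true vV.
    have := cv c vc; rewrite /pending; case: (marked T c) => /= [_|/negbTE ->] <-.
      by rewrite !addn0 addn1 => <-; rewrite ltnS leqnn.
    by rewrite ltnSn andbT addn0 !addn1 => -[<-]; rewrite leqnn orbT.
  exists (blow_down_vertex T v true); split; first exact: blow_down_vertex_norm_state.
    exact: blow_down_vertex_reach.
  by rewrite -(blow_down_vertex_npend true pv vV) ltnS leqnn.
have [v0|v0] := eqVneq (wt T v) 0.
  have [[c vc]|leaf] := child_or_leaf T v.
    have [/andP[mp' mc]|mab] := boolP (marked T (par T v) && marked T c).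
      case: (zero_isolated iT vV pv v0 mp') => c' vc'.
      by rewrite (norm_state_unary iT _ vc' vc) //; case/andP: pv.
    exists (contract T v c); split; first exact: contract_norm_state.
      exact: contract_reach.
    apply/orP; left; apply: leq_trans (contract_npend iT pv vV vc).
    by rewrite addn1 leq_addr.
  have [mp'|mp'] := boolP (marked T (par T v)).
    by case: (zero_isolated iT vV pv v0 mp') => c; rewrite (negbTE (leaf c)).
  have pp : pending T (par T v) by move: mp; rewrite /pending (negbTE mp').
  have [T1 [v' [iT1 r1 n1 [vV1 pv1 w1 pp1 wp1]]]] := clear_leaf_parent iT vV pv v0
    leaf pp erefl.
  have vr1 := pending_nrt iT1 pv1.
  have pV1 := wf_parV (norm_state_wf iT1) vV1 vr1.
  have ch : child T1 (par T1 v') v' by rewrite /child vV1 vr1 eqxx.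
  have mab : ~~ (marked T1 (par T1 (par T1 v')) && marked T1 v').
    by rewrite negb_and; case/andP: pv1 => ->; rewrite orbT.
  exists (contract T1 (par T1 v') v'); split; first exact: contract_norm_state.
    by apply: tree_reach_trans r1 _; apply: contract_reach.
  apply/orP; left; apply: leq_trans n1; apply: leq_trans (contract_npend iT1 pp1 pV1
    ch).
  by rewrite addn1 leq_addr.
have wr : w != rt T by apply: contraNneq wN => ->; case: wfT.
have [m mE] : exists m : nat, wt T v = m.+1.
  by exists (`|wt T v|%N.-1); move: v2 v1 v0; lia.
have [[c vc]|leaf] := child_or_leaf T v.
  have /and3P[cV cr /eqP pc] := vc.
  have cv' := child_neq iT vc.
  have cw : (c == w) = false by apply: contraNF wN => /eqP <-.
  pose T1 := blow_up_edge T c w true false.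
  have npc := cv c vc.
  have iT1 : norm_state T1.
    apply: blow_up_edge_norm_state => //; first by rewrite pc; case/andP: pv => _ ->;
      rewrite orbT.
      case mc : (marked T c) => //=; move: npc; rewrite /pending mc /= => tc.
      by have := norm_state_done iT cV; rewrite mc => /(_ isT tc) h; lia.
    case mc : (marked T c); [by left | right=> d cd].
    apply/negP=> pd; have /and3P[dV dr /eqP pcd] := cd.
    have := norm_state_todo iT dV dr pd; rewrite pcd mc /= => tc.
    by move: npc; rewrite /pending mc tc.
  have n1 : npend T1 = (npend T).+1.
    by have := blow_up_edge_npend true false wfT cV wN;
      rewrite -/T1 (negbTE npc) andbF !addn0.
  have [|||||||T' [iT' r' n']] := @absorb_pos m T1 v w iT1.
  + by rewrite inE vV orbT.
  + by move: pv; rewrite /pending /= vw /= (eq_sym v) (negbTE cv').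
  + by rewrite /= vw pc eqxx orbT mE -addn1 PoszD addrK.
  + by rewrite /child /= inE !eqxx wr pc eqxx.
  + by rewrite /pending /= eqxx.
  + by rewrite /= eqxx.
  + move=> d; rewrite /child /= inE /pending; case: (eqVneq d w) => [->|dw] /=.
      by rewrite pc vw andbF.
    case/and3P=> dV dr; case: (eqVneq d c) => [->|dc'] /=; first by rewrite cw andbF.
    by move/eqP=> h; have := wf_parV wfT dV dr; rewrite h (negbTE wN).
  exists T'; split=> //.
    exact: tree_reach_trans (blow_up_edge_reach true false wfT cV cr wN) r'.
  by move: n'; rewrite n1 addn2 ltnS => ->.
pose T1 := blow_up_vertex T v w true.
have iT1 : norm_state T1 by exact: blow_up_vertex_norm_state.
have n1 : npend T1 = (npend T).+1 := blow_up_vertex_npend v true wN.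
have [|||||||T' [iT' r' n']] := @absorb_pos m T1 v w iT1.
+ by rewrite inE vV orbT.
+ by move: pv; rewrite /pending /= vw.
+ by rewrite /= vw eqxx mE -addn1 PoszD addrK.
+ by rewrite /child /= inE !eqxx wr.
+ by rewrite /pending /= eqxx.
+ by rewrite /= eqxx.
+ move=> d; rewrite /child /= inE; case: (eqVneq d w) => [->|dw] /=.
    by rewrite vw andbF.
  by case/and3P=> dV dr /eqP h; have := wf_parV wfT dV dr; rewrite h (negbTE wN).
exists T'; split=> //.
  exact: tree_reach_trans (blow_up_vertex_reach true wfT vV wN) r'.
by move: n'; rewrite n1 addn2 ltnS => ->.
Qed.

Lemma seq_argmax (s : seq nat) (P : pred nat) (f : nat -> nat) : has P s ->
  exists v, [/\ v \in s, P v & {in s, forall u, P u -> (f u <= f v)%N}].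
Proof.
elim: s => //= a s IH; have [hs _|hs] := boolP (has P s).
  have [v [vs Pv vmax]] := IH hs.
  have [Pa|Pa] := boolP (P a && (f v < f a)%N).
    case/andP: Pa => Pa lt; exists a; rewrite mem_head; split=> // u.
    rewrite inE => /orP[/eqP ->//|us] Pu; apply: leq_trans (vmax u us Pu) (ltnW lt).
  exists v; rewrite inE vs orbT; split=> // u; rewrite inE => /orP[/eqP ->|/vmax//] Pu.
  by move: Pa; rewrite Pu /= -leqNgt.
rewrite orbF => Pa; exists a; rewrite mem_head; split=> // u.
rewrite inE => /orP[/eqP ->//|us Pu].
by case/negP: hs; apply/hasP; exists u.
Qed.

(** A pending vertex of largest rank has no pending child, so [reduce_step]
    applies; the pair (number of pending vertices, size) decreases
    lexicographically. *)
Lemma reduce_all T : norm_state T -> exists T', [/\ norm_state T', tree_reach T T' &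
  npend T' = 0%N].
Proof.
suff H n k : forall T, norm_state T -> (npend T <= n)%N -> (size (verts T) <= k)%N ->
    exists T', [/\ norm_state T', tree_reach T T' & npend T' = 0%N].
  by move=> iT; apply: H (leqnn _) (leqnn _).
elim: n k => [|n IHn] k; first move=> {}T iT.
  by rewrite leqn0 => /eqP n0 _; exists T; split=> //; apply: tree_reach_refl.
elim: k => [|k IHk] {}T iT nT kT.
  move: kT; rewrite leqn0 size_eq0 => /eqP V0.
  by have [_ + _] := norm_state_wf iT; rewrite V0.
have [hp|hp] := boolP (has (pending T) (verts T)); last first.
  exists T; split=> //; first exact: tree_reach_refl.
  by apply/eqP; rewrite /npend -leqn0 leqNgt -has_count.
have [v [vV pv vmax]] := seq_argmax (rk T) hp.
have [|T1 [iT1 r1 /orP n1]] := reduce_step iT vV pv.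
  move=> c /and3P[cV cr /eqP pc]; apply/negP=> pdc.
  by have := vmax c cV pdc; rewrite leqNgt -pc (wf_rk (norm_state_wf iT)).
have [T' [iT' r' n']] : exists T', [/\ norm_state T', tree_reach T1 T' &
  npend T' = 0%N].
  case: n1 => [lt|/andP[le lt]].
    by apply: (IHn (size (verts T1))) => //; rewrite -ltnS; apply: leq_trans lt _.
  by apply: IHk => //; [apply: leq_trans le _ | rewrite -ltnS; apply: leq_trans lt _].
by exists T'; split=> //; apply: tree_reach_trans r1 r'.
Qed.

(** * Definiteness of matrices *)

Definition mxform (R : pzRingType) n (A : 'M[R]_n) (x y : 'rV[R]_n) : R :=
  (x *m A *m y^T) 0 0.

Lemma mxformE (R : comPzRingType) n (A : 'M[R]_n) x y :
  mxform A x y = \sum_i \sum_j A i j * x 0 i * y 0 j.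
Proof.
rewrite /mxform mxE exchange_big /=; apply: eq_bigr => j _.
by rewrite !mxE big_distrl; apply: eq_bigr => i _ /=; ring.
Qed.

Lemma mxformC (R : comPzRingType) n (A : 'M[R]_n) x y : A^T = A ->
  mxform A x y = mxform A y x.
Proof.
move=> symA; rewrite !mxformE exchange_big; apply: eq_bigr => i _;
  apply: eq_bigr => j _.
by rewrite -{1}symA mxE /=; ring.
Qed.

Lemma mxformD (R : comPzRingType) n (A : 'M[R]_n) x y : A^T = A ->
  mxform A (x + y) (x + y) = mxform A x x + mxform A x y + mxform A y x + mxform A y y.
Proof.
move=> symA; have D u v t : mxform A (u + v) t = mxform A u t + mxform A v t.
  by rewrite /mxform !mulmxDl mxE.
rewrite D (mxformC x) // D (mxformC y (x + y)) // D (mxformC y x) //.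
by rewrite !addrA.
Qed.

(** The form splits orthogonally into the block P and its orthogonal
    complement.  Here [M] describes the conditions that [z] is supported on P and that
    z A agrees with x A on P; it is invertible because the block is definite,
    and [x - z] then lies in the complement. *)
Lemma mxform_neg_block n (A : 'M[rat]_n) (P : pred 'I_n) : A^T = A ->
  (forall x : 'rV_n, x != 0 -> (forall i, P i -> (x *m A) 0 i = 0) ->
    mxform A x x < 0) ->
  (forall x : 'rV_n, x != 0 -> (forall i, ~~ P i -> x 0 i = 0) -> mxform A x x < 0) ->
  forall x : 'rV_n, x != 0 -> mxform A x x < 0.
Proof.
move=> symA negN negC x x0.
pose M : 'M[rat]_n := \matrix_(i, j) (if P j then A i j else (i == j)%:R).
have ME (y : 'rV_n) i : (y *m M) 0 i = if P i then (y *m A) 0 i else y 0 i.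
  rewrite mxE; case: ifP => Pi.
    by rewrite mxE; apply: eq_bigr => j _; rewrite mxE Pi.
  rewrite (bigD1 i) //= mxE Pi eqxx mulr1 big1 ?addr0 // => j ji.
  by rewrite mxE Pi (negbTE ji) mulr0.
have orthF (y z : 'rV_n) : (forall i, P i -> (y *m A) 0 i = 0) ->
    (forall i, ~~ P i -> z 0 i = 0) -> mxform A y z = 0.
  move=> yP zP; rewrite /mxform mxE big1 // => i _; rewrite [z^T _ _]mxE.
  by have [Pi|Pi] := boolP (P i); [rewrite yP // mul0r | rewrite zP // mulr0].
have unitM : M \in unitmx.
  rewrite -row_free_unit -kermx_eq0; apply/rowV0P => u /sub_kermxP uM.
  apply/eqP/negPn/negP=> u0.
  have uP i : P i -> (u *m A) 0 i = 0.
    by move=> Pi; have := ME u i; rewrite uM Pi mxE.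
  have uNP i : ~~ P i -> u 0 i = 0.
    by move=> Pi; have := ME u i; rewrite uM (negbTE Pi) mxE.
  by have := negC u u0 uNP; rewrite orthF // ltxx.
pose r : 'rV_n := \row_i (if P i then (x *m A) 0 i else 0).
pose z := r *m invmx M; pose y := x - z.
have zM : z *m M = r by rewrite mulmxKV.
have zNP i : ~~ P i -> z 0 i = 0.
  by move=> Pi; have := ME z i; rewrite zM (negbTE Pi) mxE (negbTE Pi).
have yP i : P i -> (y *m A) 0 i = 0.
  move=> Pi; rewrite mulmxBl mxE [X in _ + X]mxE.
  by have := ME z i; rewrite zM Pi [r _ _]mxE Pi => ->; rewrite subrr.
have yz := orthF y z yP zNP.
have zy : mxform A z y = 0 by rewrite mxformC.
have xE : x = y + z by rewrite subrK.
rewrite xE mxformD // yz zy !addr0.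
have [y0|y0] := eqVneq y 0; have [z0|z0] := eqVneq z 0.
- by move: x0; rewrite xE y0 z0 addr0 eqxx.
- by rewrite y0 /mxform !mul0mx mxE add0r; apply: negC.
- by rewrite z0 /mxform !mul0mx [X in _ + X]mxE addr0; apply: negN.
- by have := negC z z0 zNP; have := negN y y0 yP; rewrite /mxform; lra.
Qed.

Definition sesq (F : fieldType) n (A : 'I_n -> 'I_n -> F) (x y : 'I_n -> F) : F :=
  \sum_i \sum_j A i j * x i * y j.

(** Lagrange reduction: completing the square in the first variable.  The two
    arguments are kept apart so that the identity also covers a vector paired
    with its conjugate. *)
Lemma sesq_recl (F : fieldType) n (A : 'I_n.+1 -> 'I_n.+1 -> F) (x y : 'I_n.+1 -> F) :
  (forall i j, A i j = A j i) -> A 0 0 != 0 ->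
  let l (x : 'I_n.+1 -> F) := x 0 + (\sum_i A 0 (lift 0 i) * x (lift 0 i)) / A 0 0 in
  sesq A x y = A 0 0 * l x * l y +
    sesq (fun i j => A (lift 0 i) (lift 0 j) - A 0 (lift 0 i) * A 0 (lift 0 j) / A 0 0)
      (x \o lift 0) (y \o lift 0).
Proof.
move=> symA a0 l; pose b (x : 'I_n.+1 -> F) := \sum_i A 0 (lift 0 i) * x (lift 0 i).
have -> : sesq (fun i j => A (lift 0 i) (lift 0 j) - A 0 (lift 0 i) * A 0 (lift 0 j)
  / A 0 0)
      (x \o lift 0) (y \o lift 0) =
    \sum_i \sum_j A (lift 0 i) (lift 0 j) * x (lift 0 i) * y (lift 0 j) - b x * b y /
      A 0 0.
  rewrite /sesq -mulrA {1}/b mulr_suml -sumrB; apply: eq_bigr => i _.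
  rewrite /b mulr_suml mulr_sumr -sumrB; apply: eq_bigr => j _ /=; ring.
rewrite /sesq big_ord_recl big_ord_recl /=.
rewrite [X in _ + X](eq_bigr (fun i => A 0 (lift 0 i) * x (lift 0 i) * y 0 +
   \sum_j A (lift 0 i) (lift 0 j) * x (lift 0 i) * y (lift 0 j))); last first.
  by move=> i _; rewrite big_ord_recl /= symA.
rewrite big_split /= -mulr_suml -/(b x) /l -/(b x) -/(b y).
have -> : \sum_(i < n) A 0 (lift 0 i) * x 0 * y (lift 0 i) = x 0 * b y.
  by rewrite /b big_distrr; apply: eq_bigr => i _ /=; ring.
by field.
Qed.

(** A rational form that is negative on rational vectors is a combination of
    squares with negative rational coefficients, by Lagrange reduction; such a
    combination stays negative on complex vectors. *)
Lemma sesq_neg_algC n (A : 'I_n -> 'I_n -> rat) :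
  (forall i j, A i j = A j i) ->
  (forall x, (exists i, x i != 0) -> sesq A x x < 0) ->
  forall z : 'I_n -> algC, (exists i, z i != 0) ->
    sesq (fun i j => ratr (A i j)) z (fun i => (z i)^*) < 0.
Proof.
elim: n A => [|n IH] A symA negA z [i zi]; first by case: i zi.
have a0 : A 0 0 < 0.
  pose d (j : 'I_n.+1) : rat := (j == 0)%:R.
  have d0 j : j != 0 -> d j = 0 by rewrite /d => /negbTE ->.
  suff <- : sesq A d d = A 0 0 by apply: negA; exists 0.
  rewrite /sesq (bigD1 0) //= (bigD1 0) //= !big1 ?addr0.
  - by rewrite /d !mulr1.
  - by move=> j j0; rewrite big1 // => k _; rewrite (d0 j j0) mulr0 mul0r.
  - by move=> j j0; rewrite (d0 j j0) mulr0.
have a0' : (ratr (A 0 0) : algC) < 0 by rewrite ltrq0.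
rewrite sesq_recl ?ltr0_neq0 //; last by move=> j k; rewrite symA.
set l := (X in X + _); pose S i j := A (lift 0 i) (lift 0 j) - A 0 (lift 0 i) * A 0
  (lift 0 j) / A 0 0.
set q := sesq _ _ _.
have qE : q = sesq (fun i j => ratr (S i j)) (z \o lift 0) (fun i => ((z \o lift 0)
  i)^*).
  apply: eq_bigr => j _; apply: eq_bigr => k _.
  by rewrite /S rmorphB /= fmorph_div rmorphM.
have negS x : (exists i, x i != 0) -> sesq S x x < 0.
  move=> [j xj]; pose x0 := - (\sum_i A 0 (lift 0 i) * x i) / A 0 0.
  pose x' i := if unlift 0 i is Some j then x j else x0.
  have x'E k : x' (lift 0 k) = x k by rewrite /x' liftK.
  have x'0 : x' 0 = x0 by rewrite /x' unlift_none.
  have := negA x'; rewrite sesq_recl ?ltr0_neq0 // x'0.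
  have -> : x0 + (\sum_i A 0 (lift 0 i) * x' (lift 0 i)) / A 0 0 = 0.
    rewrite (eq_bigr (fun i => A 0 (lift 0 i) * x i)); last by move=> k _; rewrite x'E.
    by rewrite /x0 -mulrDl addNr mul0r.
  rewrite !mulr0 add0r => h; suff -> : sesq S x x = sesq S (x' \o lift 0) (x' \o lift
    0).
    by apply: h; exists (lift 0 j); rewrite x'E.
  by apply: eq_bigr => k _; apply: eq_bigr => m _ /=; rewrite !x'E.
set lz := z 0 + (\sum_i ratr (A 0 (lift 0 i)) * z (lift 0 i)) / ratr (A 0 0) : algC.
have lE : l = ratr (A 0 0) * (`|lz| ^+ 2).
  rewrite /l normCK mulrA; congr (_ * _); rewrite /lz rmorphD /= fmorph_div /=
    (conj_Crat (Crat_rat _)).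
  congr (_ + _ / _); rewrite rmorph_sum; apply: eq_bigr => k _ /=.
  by rewrite rmorphM /= (conj_Crat (Crat_rat _)).
have l0 : l <= 0 by rewrite lE; apply: mulr_le0_ge0; [apply: ltW | apply: exprn_ge0].
have symS j k : S j k = S k j by rewrite /S (symA (lift 0 j)) (mulrC (A 0 (lift 0 j))).
have [/existsP[j zj]|/existsPn z0] := boolP [exists j, z (lift 0 j) != 0].
  rewrite qE; have := IH S symS negS (z \o lift 0) (ex_intro _ j zj).
  by rewrite -[X in _ -> _ < X]addr0 => h; apply: ler_ltD.
have z0' j : z (lift 0 j) = 0 by apply/eqP; rewrite -[_ == _]negbK z0.
have i0 : z 0 != 0 by case: (unliftP 0 i) zi => [j ->|-> //]; rewrite z0' eqxx.
have -> : q = 0.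
  by rewrite qE /sesq big1 // => j _; rewrite big1 // => k _;
    rewrite /= z0' mulr0 mul0r.
rewrite addr0 lE; have -> : lz = z 0.
  by rewrite /lz big1 ?mul0r ?addr0 // => j _; rewrite z0' mulr0.
by rewrite pmulr_llt0 // exprn_gt0 // normr_gt0.
Qed.

(** For an eigenvector v of eigenvalue a, the Hermitian value of the form at v
    is a times the squared length of v. *)
Lemma negative_definite_rat (G : plumbing_tree) :
  (forall x : 'rV_(nvert G), x != 0 -> mxform (framing_mxQ G) x x < 0) ->
  negative_definite G.
Proof.
move=> neg a /eigenvalueP[v vA v0].
have symF i j : framing_mxQ G i j = framing_mxQ G j i.
  by rewrite !mxE eq_sym pt_sym; case: eqP => [->|].
have [k vk] : exists k, v 0 k != 0.
  apply/existsP; rewrite -negb_forall; apply: contra v0 => /forallP h.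
  by apply/eqP/rowP=> i; rewrite mxE; apply/eqP.
have : sesq (fun i j => ratr (framing_mxQ G i j)) (v 0) (fun i => (v 0 i)^*) < 0.
  apply: sesq_neg_algC => //; last by exists k.
  move=> x [i xi]; have := neg (\row_i x i); rewrite mxformE.
  have -> : \sum_i \sum_j framing_mxQ G i j * (\row_i x i) 0 i * (\row_i x i) 0 j =
            sesq (framing_mxQ G) x x.
    by apply: eq_bigr => p _; apply: eq_bigr => q _; rewrite !mxE.
  by apply; apply: contra_neq xi => /rowP/(_ i); rewrite !mxE.
have -> : sesq (fun i j => ratr (framing_mxQ G i j)) (v 0) (fun i => (v 0 i)^*) =
    a * \sum_j `|v 0 j| ^+ 2.
  rewrite /sesq exchange_big big_distrr /=; apply: eq_bigr => j _.
  rewrite normCK mulrA -mulr_suml; congr (_ * _).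
  have := congr1 (fun u : 'rV_ _ => u 0 j) vA; rewrite !mxE => <-.
  by apply: eq_bigr => i _; rewrite !mxE ratr_int mulrC.
rewrite pmulr_llt0 // (bigD1 k) //= ltr_pwDl ?exprn_gt0 ?normr_gt0 //.
by rewrite sumr_ge0 // => j _; apply: exprn_ge0.
Qed.

(** * From the signed form to the framing matrix *)

(** The product of the edge signs on the way to the root, with [n] as fuel. *)
Fixpoint path_sign T n v : bool :=
  if n is n'.+1 then
    if v == rt T then false else esgn T v (+) path_sign T n' (par T v)
  else false.

(** On a tree, every choice of edge signs comes from a choice of vertex signs. *)
Lemma vertex_sign T : wf T -> exists s : nat -> bool,
  {in verts T, forall v, v != rt T -> s v = esgn T v (+) s (par T v)}.
Proof.
move=> wfT; have stable n m v : v \in verts T -> (rk T v < n)%N -> (rk T v < m)%N ->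
    path_sign T n v = path_sign T m v.
  elim: n m v => // n IH [//|m] v vV; rewrite !ltnS /= => ln lm.
  case: eqVneq => // vr; congr (_ (+) _); apply: IH; first exact: wf_parV.
    by apply: leq_trans (wf_rk wfT vV vr) ln.
  by apply: leq_trans (wf_rk wfT vV vr) lm.
exists (fun v => path_sign T (rk T v).+1 v) => v vV vr.
rewrite [LHS]/= (negbTE vr); congr (_ (+) _).
by apply: stable => //; [apply: wf_parV | apply: wf_rk].
Qed.

Lemma form_delta T a b : wf T -> a \in verts T -> b \in verts T ->
  form T (delta a) (delta b) = (if a == b then (wt T a)%:~R else 0) +
    (if (a != rt T) && (par T a == b) then (-1) ^+ esgn T a else 0) +
    (if (b != rt T) && (par T b == a) then (-1) ^+ esgn T b else 0).
Proof.
move=> wfT aV bV; have uT : uniq (verts T) by case: wfT.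
pose Ea : rat := (if a == b then (wt T a)%:~R else 0) +
  (if (a != rt T) && (par T a == b) then (-1) ^+ esgn T a else 0).
pose Eb : rat := if (b != rt T) && (par T b == a) then (-1) ^+ esgn T b else 0.
rewrite -/Eb -/Ea /form.
rewrite (eq_bigr (fun v => (if v == a then Ea else 0) + (if v == b then Eb else 0))).
  by rewrite big_split /= !sum_delta.
move=> v _; rewrite /term /delta /Ea /Eb.
case: (eqVneq v a) => [->|va].
  case: (eqVneq a b) => [<-|ab].
    by case: (a == rt T); case: (par T a == a) => /=; ring.
  by case: (a == rt T); case: (par T a == b); case: (par T a == a) => /=; ring.
case: (eqVneq v b) => [->|vb]; last by case: (v == rt T) => /=; ring.
by case: (b == rt T); case: (par T b == a) => /=; ring.
Qed.

Section Realized.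
Variables (G : plumbing_tree) (T : rtree) (phi : vertex G -> nat) (s : nat -> bool).
Hypotheses (wfT : wf T) (phi_inj : injective phi).
Hypothesis phiV : forall u, u \in verts T <-> exists i, phi i = u.
Hypothesis phiA : forall i j, adj i j = adjT T (phi i) (phi j).
Hypothesis phiW : forall i, weight i = wt T (phi i).
Hypothesis sE : {in verts T, forall v, v != rt T -> s v = esgn T v (+) s (par T v)}.

Lemma label_in i : phi i \in verts T. Proof. by apply/phiV; exists i. Qed.

Lemma realize_sum (F : nat -> rat) : \sum_(u <- verts T) F u = \sum_i F (phi i).
Proof.
rewrite (perm_big (map phi (index_enum (vertex G)))) ?big_map //.
apply: uniq_perm; first by case: wfT.
  by rewrite map_inj_uniq // index_enum_uniq.
move=> u; apply/idP/mapP => [/phiV[i <-]|[i _ ->]]; last exact: label_in.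
by exists i => //; rewrite mem_index_enum.
Qed.

Lemma form_entry i j : form T (delta (phi i)) (delta (phi j)) =
  (-1) ^+ s (phi i) * (-1) ^+ s (phi j) * framing_mxQ G i j.
Proof.
rewrite form_delta ?label_in // !mxE (inj_eq phi_inj) phiA /adjT.
case: (eqVneq i j) => [<-|ij].
  rewrite phiW -signr_addb addbb mul1r.
  suff /negbTE -> : ~~ ((phi i != rt T) && (par T (phi i) == phi i)) by rewrite !addr0.
  by rewrite negb_and negbK; case: eqVneq => //= r; rewrite wf_par_neq ?label_in.
rewrite add0r; case h1: (_ && _); case h2: (_ && _) => /=.
- case/andP: h1 => r1 /eqP p1; case/andP: h2 => r2 /eqP p2.
  have lt1 := wf_rk wfT (label_in i) r1; have lt2 := wf_rk wfT (label_in j) r2.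
  by move: lt1 lt2; rewrite p1 p2 => lt1 /(ltn_trans lt1); rewrite ltnn.
- case/andP: h1 => r1 /eqP p1; rewrite addr0 mulr1 -signr_addb.
  by rewrite (sE (label_in i) r1) p1 -addbA addbb addbF.
- case/andP: h2 => r2 /eqP p2; rewrite add0r mulr1 -signr_addb.
  by rewrite (sE (label_in j) r2) p2 addbCA addbb addbF.
- by rewrite addr0 mulr0.
Qed.

Definition signed_row (x : nat -> rat) : 'rV[rat]_(nvert G) :=
  \row_i ((-1) ^+ s (phi i) * x (phi i)).

Lemma form_mx x y : form T x y = mxform (framing_mxQ G) (signed_row x) (signed_row y).
Proof.
rewrite form_expand // realize_sum mxformE exchange_big /=; apply: eq_bigr => j _.
rewrite formC form_expand // realize_sum mulr_sumr; apply: eq_bigr => i _.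
rewrite formC form_entry !mxE; ring.
Qed.

Lemma signed_row_onto r : exists x, signed_row x = r.
Proof.
pose x u := if [pick i | phi i == u] is Some i then (-1) ^+ s u * r 0 i else 0.
exists x; apply/rowP=> i; rewrite !mxE /x.
case: pickP => [j /eqP/phi_inj ->|/(_ i)]; last by rewrite eqxx.
by rewrite mulrA -signr_addb addbb mul1r.
Qed.

Lemma signed_row_neq0 x : signed_row x != 0 <-> nontriv T x.
Proof.
split=> [h|[u /phiV[i <-] xi]].
  have /existsP[i xi] : [exists i, x (phi i) != 0].
    apply: contraR h; rewrite negb_exists => /forallP h.
    apply/eqP/rowP=> i; rewrite !mxE; have := h i; rewrite negbK => /eqP ->.
    by rewrite mulr0.
  by exists (phi i) => //; apply: label_in.
apply: contra_neq xi => /rowP/(_ i); rewrite !mxE => /eqP.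
by rewrite mulf_eq0 signr_eq0 /= => /eqP.
Qed.

Lemma form_row x i : form T x (delta (phi i)) =
  (-1) ^+ s (phi i) * (signed_row x *m framing_mxQ G) 0 i.
Proof.
rewrite form_mx /mxform mxE (bigD1 i) //= big1 ?addr0.
  by rewrite [(signed_row (delta _))^T _ _]mxE [signed_row (delta _) _ _]mxE
     /delta eqxx mulr1 mulrC.
move=> j ji; rewrite [(signed_row (delta _))^T _ _]mxE [signed_row (delta _) _ _]mxE.
by rewrite /delta (inj_eq phi_inj) (negbTE ji) !mulr0.
Qed.

Lemma orth_row x : orth T x <->
  (forall i, ~~ marked T (phi i) -> (signed_row x *m framing_mxQ G) 0 i = 0).
Proof.
split=> [o i mi|h u /phiV[i <-] mi]; last by rewrite form_row h // mulr0.
have := o _ (label_in i) mi; rewrite form_row => /eqP.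
by rewrite mulf_eq0 signr_eq0 /= => /eqP.
Qed.

Lemma framing_sym : (framing_mxQ G)^T = framing_mxQ G.
Proof. by apply/matrixP=> i j; rewrite !mxE eq_sym pt_sym; case: eqP => [->|]. Qed.
End Realized.

(** Absorb each edge term into the square [sq] of the sum or difference of its
    ends.  Every unmarked vertex contributes at most -2 times its own square
    and has at most two neighbours, so the form is at most minus the sum of these
    squares.  If all of them vanish, the absolute value of [x] is constant
    along edges, and it is 0 at the root. *)
Lemma unmarked_neg T x : norm_state T -> npend T = 0%N -> nontriv T x ->
  {in verts T, forall v, marked T v -> x v = 0} -> form T x x < 0.
Proof.
move=> iT n0 nx x0; have wfT := norm_state_wf iT; have uT : uniq (verts T) by case: wfT.
have wt_le v : v \in verts T -> ~~ marked T v -> wt T v <= -2.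
  move=> vV mv; apply: norm_state_done => //.
  move: n0 => /eqP; rewrite -leqn0 leqNgt -has_count => /hasPn/(_ v vV).
  by rewrite /pending mv.
pose sq v : rat := if v == rt T then 0 else (x v - (-1) ^+ esgn T v * x (par T v)) ^+ 2.
have le : form T x x <= - \sum_(v <- verts T) sq v.
  have tE v : v \in verts T -> term T x x v <= - (x v ^+ 2) + 
      (if v == rt T then 0 else x (par T v) ^+ 2) - sq v.
    move=> vV; have w2 : (wt T v)%:~R * x v * x v <= - 2 * x v ^+ 2.
      have [/(x0 v vV) ->|mv] := boolP (marked T v); first by rewrite expr0n /= !mulr0.
      have : (wt T v)%:~R <= (-2)%:~R :> rat by rewrite ler_int wt_le.
      by rewrite -mulrA -expr2; apply: ler_wpM2r; rewrite sqr_ge0.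
    rewrite /term /sq; case: eqVneq => [vr|vr].
      by move: w2; rewrite (x0 v vV) ?vr ?norm_state_rt //; lra.
    move: w2; case: (esgn T v); rewrite ?expr1 ?expr0; nra.
  (* An unmarked vertex is the parent of at most one vertex. *)
  have cnt : \sum_(v <- verts T) (if v == rt T then 0 else x (par T v) ^+ 2) <=
             \sum_(v <- verts T) x v ^+ 2.
    have -> : \sum_(v <- verts T) (if v == rt T then 0 else x (par T v) ^+ 2) =
        \sum_(p <- verts T) \sum_(v <- verts T) (if child T p v then x p ^+ 2 else 0).
      rewrite exchange_big; apply: eq_big_seq => v vV /=.
      case: eqVneq => vr.
        by rewrite big1 // => p _; rewrite /child vr eqxx andbF.
      rewrite -[LHS](@sum_delta (verts T) (par T v)) ?wf_parV //; apply: eq_bigr => p _.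
      by rewrite /child vV vr eq_sym /=; case: eqVneq => [->|].
    rewrite big_seq [X in _ <= X]big_seq; apply: ler_sum => p pV.
    have [/(x0 p pV) ->|mp] := boolP (marked T p).
      by rewrite big1 ?sqr_ge0 // => v _; rewrite expr0n /= if_same.
    have [[c pc]|leaf] := child_or_leaf T p.
      rewrite (eq_bigr (fun v => if v == c then x p ^+ 2 else 0)).
        by rewrite sum_delta //; case/and3P: pc.
      move=> v _; case: (eqVneq v c) => [->|vc]; first by rewrite pc.
      by rewrite ifF //; apply: contraNF vc => h;
        apply/eqP/(norm_state_unary iT mp h pc).
    by rewrite big1 ?sqr_ge0 // => v _; rewrite (negbTE (leaf v)).
  have : form T x x <= \sum_(v <- verts T) (- (x v ^+ 2) + 
      (if v == rt T then 0 else x (par T v) ^+ 2) - sq v).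
    by rewrite /form big_seq [X in _ <= X]big_seq; apply: ler_sum.
  rewrite !big_split /= !sumrN; move: cnt; lra.
have sq_ge0 v : 0 <= sq v by rewrite /sq; case: ifP => // _; apply: sqr_ge0.
have s0 : 0 <= \sum_(v <- verts T) sq v by apply: sumr_ge0.
rewrite lt_neqAle (le_trans le) ?oppr_le0 // andbT; apply/eqP=> f0.
have sz : \sum_(v <- verts T) sq v == 0.
  by rewrite eq_le s0 andbT; move: le; rewrite f0 oppr_ge0.
have sqz v : v \in verts T -> sq v = 0.
  by move=> vV; apply/eqP; move: sz; rewrite psumr_eq0 // => /allP/(_ v vV).
have xz n v : v \in verts T -> (rk T v < n)%N -> x v = 0.
  elim: n v => // n IH v vV ltn.
  have [->|vr] := eqVneq v (rt T); first by apply: x0; rewrite ?norm_state_rt //;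
    case: wfT.
  have xp : x (par T v) = 0.
    apply: IH; first exact: wf_parV.
    exact: leq_trans (wf_rk wfT vV vr) ltn.
  have := sqz v vV; rewrite /sq (negbTE vr) xp mulr0 subr0 => /eqP.
  by rewrite sqrf_eq0 => /eqP.
by case: nx => v vV; rewrite (xz _ v vV (ltnSn _)) eqxx.
Qed.

Lemma realize_negative_definite T G : norm_state T -> npend T = 0%N -> realize G T ->
  negative_definite G.
Proof.
move=> iT n0 [phi [phi_inj phiV phiA phiW]]; have wfT := norm_state_wf iT.
have [s sE] := vertex_sign wfT.
have onto := signed_row_onto s phi_inj.
have neq0 := signed_row_neq0 s phiV.
have fE := form_mx wfT phi_inj phiV phiA phiW sE.
apply: negative_definite_rat.
apply: (@mxform_neg_block _ _ (fun i => ~~ marked T (phi i)) (framing_sym G)).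
  move=> r; have [x <-] := onto r; move=> /neq0 nx o; rewrite -fE;
    apply: norm_state_wneg => //.
  exact/(orth_row wfT phi_inj phiV phiA phiW sE).
move=> r; have [x <-] := onto r; move=> /neq0 nx h; rewrite -fE;
  apply: unmarked_neg => //.
move=> v /phiV[i <-] mi; have := h i; rewrite negbK mi mxE => /(_ isT)/eqP.
by rewrite mulf_eq0 signr_eq0 /= => /eqP.
Qed.

(** * Rooting a plumbing tree *)

Section Rooting.
Variable G : plumbing_tree.
Implicit Types x y v : vertex G.

(** Every edge of a tree is a bridge: a simple path joining its ends elsewhere
    would close up to a cycle. *)
Lemma tree_bridge x y : adj x y ->
  ~~ connect [rel a b | adj a b && ~~ ((a == x) && (b == y) || (a == y) && (b == x))]
    x y.
Proof.
set e := [rel a b | _] => axy; apply/negP=> /connectP[p ep yE].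
case/shortenP: ep yE => p' ep' up' _ yE.
have sub : subrel e (@adj G) by move=> a b /andP[].
have cyc : ucycle (@adj G) (x :: p').
  rewrite /ucycle /= -(cons_uniq x p') up' andbT rcons_path (sub_path sub ep') /=.
  by rewrite -yE pt_sym.
have := pt_acyclic cyc; case: p' ep' yE {up' cyc} => [_ /= yx|z [|//]].
  by move: axy; rewrite yx pt_irr.
by rewrite /= andbT => /[swap] <-; rewrite !eqxx andbF.
Qed.

(** The length of a shortest path to [r]; a first step of such a path leads to
    a vertex where it is smaller. *)
Lemma root_distance r : exists d : vertex G -> nat,
  d r = 0%N /\ forall v, v != r -> exists2 u, adj v u & (d u < d v)%N.
Proof.
pose P v n := [exists p : n.-tuple (vertex G), path (@adj G) r p && (last r p == v)].
have exP v : exists n, P v n.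
  have /connectP[p pp vE] := pt_connected r v.
  by exists (size p); apply/existsP; exists (in_tuple p); rewrite pp -vE eqxx.
exists (fun v => ex_minn (exP v)); split.
  case: ex_minnP => n _ /(_ 0%N) h; apply/eqP; rewrite -leqn0; apply: h.
  by apply/existsP; exists [tuple]; rewrite /= eqxx.
move=> v vr; case: ex_minnP => n /existsP[[p sp]] /= /andP[pp /eqP lp] _.
case/lastP: p pp lp sp => [|p u]; first by move=> _ /= h; rewrite h eqxx in vr.
rewrite rcons_path last_rcons => /andP[pp au] uv; subst u.
rewrite size_rcons => /eqP <-; exists (last r p); first by rewrite pt_sym.
case: ex_minnP => m _ /(_ (size p)); rewrite ltnS; apply.
by apply/existsP; exists (in_tuple p); rewrite pp eqxx.
Qed.

Section Distance.
Variables (r : vertex G) (d : vertex G -> nat).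
Hypotheses (dr : d r = 0%N).
Hypothesis (dP : forall v, v != r -> exists2 u, adj v u & (d u < d v)%N).

Lemma dist0 v : d v = 0%N -> v = r.
Proof. by move=> d0; apply/eqP; apply: contraT => /dP[u _]; rewrite d0. Qed.

Lemma connect_avoiding v y : (d y <= d v)%N -> y != v ->
  connect [rel a b | [&& adj a b, a != v & b != v]] y r.
Proof.
have [n] := ubnP (d y); elim: n y => // n IH y; rewrite ltnS => yn yv nyv.
have [->|yr] := eqVneq y r; first exact: connect0.
have [u ayu ltu] := dP yr.
have uv : u != v by apply: contraTneq ltu => ->; rewrite -leqNgt.
apply: (@connect_trans _ _ u).
  by apply: connect1; rewrite /= ayu nyv.
by apply: IH uv; [apply: leq_trans ltu yn | apply: leq_trans (ltnW ltu) yv].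
Qed.

(** If [y1] and [y2] are distinct, the edge from [v] to [y2], a descent from
    [y2] to [r] and the reverse of one from [y1] join [v] to [y1] without using
    the edge between them, since the descents avoid [v]. *)
Lemma lower_neighbour_uniq v y1 y2 : adj v y1 -> adj v y2 ->
  (d y1 <= d v)%N -> (d y2 <= d v)%N -> y1 = y2.
Proof.
move=> a1 a2 d1 d2; apply/eqP; apply: contraT => y12.
case/negP: (tree_bridge a1); set e := [rel a b | _].
pose ev := [rel a b | [&& adj a b, a != v & b != v]].
have sub : subrel ev (connect e).
  move=> a b /and3P[ab av bv]; apply: connect1.
  by rewrite /e /= ab (negbTE av) (negbTE bv) andbF.
have nv y : adj v y -> y != v by apply: contraTneq => ->; rewrite pt_irr.
have esym : symmetric ev.
  by move=> a b; rewrite /ev /= pt_sym; congr (_ && _); rewrite andbC.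
apply: (@connect_trans _ _ y2).
  apply: connect1; rewrite /e /= a2 eqxx eq_sym (negbTE y12) /=.
  by rewrite eq_sym (negbTE (nv _ a1)).
apply: (connect_sub sub); apply: (@connect_trans _ _ r).
  by apply: connect_avoiding => //; apply: nv.
by rewrite (sym_connect_sym esym); apply: connect_avoiding => //; apply: nv.
Qed.

Definition up v := odflt v [pick u | adj v u && (d u < d v)%N].

Lemma upP v : v != r -> adj v (up v) /\ (d (up v) < d v)%N.
Proof.
move=> /dP[u au ltu]; rewrite /up; case: pickP => [z /andP[//]|/(_ u)].
by rewrite au ltu.
Qed.

Definition lift_fun (A : Type) (a0 : A) (f : vertex G -> A) n :=
  if insub n is Some v then f v else a0.

Lemma lift_funE A a0 (f : vertex G -> A) v : lift_fun a0 f v = f v.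
Proof. by rewrite /lift_fun insubT //= => ltv; congr f; apply: val_inj. Qed.

Definition rooted (M : pred (vertex G)) := RTree (iota 0 (nvert G)) r
  (lift_fun 0%N (fun v => val (up v))) (lift_fun 0%N d) (lift_fun 0 (@weight G))
  (lift_fun false M) (fun=> true) (fun=> false).

Lemma rooted_V M u : u \in verts (rooted M) <-> exists i : vertex G, val i = u.
Proof.
rewrite mem_iota add0n /=; split=> [ltu|[i <-]//].
by exists (Ordinal ltu).
Qed.

Lemma rooted_wf M : wf (rooted M).
Proof.
split; rewrite ?iota_uniq ?mem_iota //=.
move=> u; rewrite mem_iota add0n /= => ltu; pose v : vertex G := Ordinal ltu.
rewrite -[u]/(val v) !lift_funE mem_iota add0n /= => vr.
by split=> //; have [] := @upP v vr.
Qed.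

Lemma rooted_adj M (i j : vertex G) : adj i j = adjT (rooted M) (val i) (val j).
Proof.
rewrite /adjT /= !lift_funE.
have upE x y : adj x y -> (d y <= d x)%N -> x != r /\ up x = y.
  move=> axy dyx; have xr : x != r.
    apply: contraTneq axy => xr; move: dyx; rewrite xr dr leqn0 => /eqP/dist0 ->.
    by rewrite pt_irr.
  by split=> //; have [a lt] := upP xr; apply: (lower_neighbour_uniq a axy _ dyx);
    apply: ltnW.
apply/idP/orP => [aij|[/andP[ir /eqP/val_inj <-]|/andP[jr /eqP/val_inj <-]]].
- case/orP: (leq_total (d j) (d i)) => le; [left|right].
    by have [ir ->] := upE _ _ aij le; rewrite ir eqxx.
  by rewrite pt_sym in aij; have [jr ->] := upE _ _ aij le; rewrite jr eqxx.
- by have [] := upP ir.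
- by rewrite pt_sym; have [] := upP jr.
Qed.

Lemma rooted_weight M (i : vertex G) : weight i = wt (rooted M) (val i).
Proof. by rewrite /= lift_funE. Qed.

Lemma rooted_realize M : realize G (rooted M).
Proof.
exists val; split; [exact: val_inj | exact: rooted_V | exact: rooted_adj | exact:
  rooted_weight].
Qed.

Lemma rooted_child M (p c : vertex G) : child (rooted M) (val p) (val c) ->
  [/\ adj p c, c != r & up c = p].
Proof.
case/and3P=> _ cr /=; rewrite lift_funE => /eqP/val_inj <-.
by split=> //; rewrite pt_sym; have [] := upP cr.
Qed.

(** Two children, together with the parent outside the root, are distinct
    neighbours. *)
Lemma rooted_unary M (p c c' : nat) :
  (forall v, ~~ M v -> (degree v <= if v == r then 1 else 2)%N) ->
  ~~ marked (rooted M) p -> child (rooted M) p c -> child (rooted M) p c' -> c = c'.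
Proof.
move=> Mdeg mp pc pc'; have pV : p \in verts (rooted M).
  by case/and3P: pc => cV cr /eqP <-; apply: wf_parV (rooted_wf M) cV cr.
have cV : c \in verts (rooted M) by case/and3P: pc.
have cV' : c' \in verts (rooted M) by case/and3P: pc'.
have [v vE] := (rooted_V M p).1 pV; have [x xE] := (rooted_V M c).1 cV.
have [y yE] := (rooted_V M c').1 cV'; subst p c c'.
have [ax xr ux] := rooted_child pc; have [ay yr uy] := rooted_child pc'.
move: mp; rewrite /= lift_funE => /Mdeg; apply: contraTeq => xy;
  rewrite -ltnNge /degree.
have xy' : x != y by apply: contraNneq xy => ->.
case: eqVneq => [vr|vr].
  apply: leq_trans (_ : #|[set x; y]| <= _)%N; first by rewrite cards2 xy'.
  by apply/subset_leq_card/subsetP=> z; rewrite !inE => /orP[] /eqP ->.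
have [au du] := upP vr; have [_] := upP xr; have [_] := upP yr; rewrite ux uy => dy dx.
apply: leq_trans (_ : #|[set up v; x; y]| <= _)%N.
  rewrite -setUA cardsU1 cards2 xy' !inE.
  suff -> : (up v == x) || (up v == y) = false by [].
  by apply/negbTE; rewrite negb_or; apply/andP; split; apply: contraTneq du => ->;
    rewrite -leqNgt ltnW.
by apply/subset_leq_card/subsetP=> z; rewrite !inE -orbA => /or3P[] /eqP ->.
Qed.

Lemma rooted_form M (x y : nat -> rat) : form (rooted M) x y =
  mxform (framing_mxQ G) (\row_i x (val i)) (\row_i y (val i)).
Proof.
rewrite (@form_mx G (rooted M) val (fun=> false) (rooted_wf M) val_inj (@rooted_V M)
  (@rooted_adj M)
  (@rooted_weight M)); last by [].
by rewrite /signed_row; congr (mxform _ _ _); apply/rowP=> i; rewrite !mxE expr0 mul1r.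
Qed.

Lemma rooted_row M (x : nat -> rat) (i : vertex G) : form (rooted M) x (delta (val i)) =
  ((\row_i x (val i)) *m framing_mxQ G) 0 i.
Proof.
rewrite (@form_row G (rooted M) val (fun=> false) (rooted_wf M) val_inj (@rooted_V M)
  (@rooted_adj M)
  (@rooted_weight M)); last by [].
rewrite expr0 mul1r; congr ((_ *m _) _ _).
by apply/rowP=> j; rewrite !mxE expr0 mul1r.
Qed.

Lemma rooted_row0 M (x : nat -> rat) : \row_(i < nvert G) x (val i) = 0 ->
  {in verts (rooted M), forall u : nat, x u = 0}.
Proof. by move=> h u /rooted_V[i <-]; have := congr1 (fun z : 'rV_ _ => z 0 i) h;
  rewrite !mxE. Qed.

(** If x B is supported on the marked vertices then it lies in the branch space,
    and its value under the inverse matrix is x B x^T. *)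
Lemma rooted_wneg (M : pred (vertex G)) : weakly_negative_definite G ->
  (forall v, M v -> (3 <= degree v)%N) -> wneg (rooted M).
Proof.
move=> [uF neg] M3 x nx ox; rewrite rooted_form; set z := \row_i _.
have z0 : z != 0 by case: nx => v vV; apply: contra_neq => h;
  apply: (rooted_row0 (M := M) h).
set F := framing_mxQ G in uF neg *.
have symF : F^T = F := framing_sym G.
have y0 : z *m F != 0 by apply: contra_neq z0 => h; rewrite -[z](mulmxK uF) h mul0mx.
have zF : (z *m F <= branch_space G)%MS.
  rewrite [X in (X <= _)%MS]row_sum_delta; apply: summx_sub => v _.
  have [dv|dv] := boolP (3 <= degree v)%N.
    by apply: scalemx_sub; apply: (sumsmx_sup v) => //; rewrite genmxE.
  have -> : (z *m F) 0 v = 0.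
    rewrite -(rooted_row M); apply: ox; first by apply/rooted_V; exists v.
    by rewrite /= lift_funE; apply: contra dv => /M3.
  by rewrite scale0r sub0mx.
by have := neg _ zF y0; rewrite mulmxK // trmx_mul symF mulmxA.
Qed.
End Distance.

(** A vertex at maximal distance from some root has no neighbour except its
    parent. *)
Lemma leaf_exists : exists v, (degree v <= 1)%N.
Proof.
pose r := Ordinal (pt_nonempty G); have [d [dr dP]] := root_distance r.
case: (@arg_maxnP _ r predT d isT) => v _ vmax; exists v.
rewrite /degree; apply/card_le1_eqP => x y; rewrite !inE => ax ay.
by apply: (lower_neighbour_uniq dP ay ax); apply: vmax.
Qed.
End Rooting.

(** * Trees without branch vertices *)

(** The new root is a leaf of weight -1 attached to the old root, which makes
    this a blow-up of a vertex in the unrooted tree. *)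
Section NewRoot.
Variables (T : rtree) (w : nat).
Hypotheses (wfT : wf T) (wN : w \notin verts T).

Definition new_root := RTree (w :: verts T) w
  (fun x => if x == rt T then w else par T x)
  (fun x => if x == w then 0%N else (rk T x).+1)
  (fun x => if x == w then -1 else wt T x + (if x == rt T then -1 else 0))
  (fun=> false) (fun=> true)
  (fun x => if x == rt T then false else esgn T x).

Let nw u : u \in verts T -> (u == w) = false.
Proof. by move=> uV; apply: contraNF wN => /eqP <-. Qed.
Let rV : rt T \in verts T. Proof. by case: wfT. Qed.

Lemma new_root_wf : wf new_root.
Proof.
split=> /=; first by rewrite wN; case: wfT.
  by rewrite inE eqxx.
move=> u; rewrite !inE; case: eqVneq => //= uw uV _.
case: (eqVneq u (rt T)) => [_|ur]; first by rewrite !eqxx.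
by rewrite (wf_parV wfT uV ur) orbT (nw (wf_parV wfT uV ur)) ltnS wf_rk.
Qed.

Lemma new_root_reach : tree_reach T new_root.
Proof.
apply: tree_reach_up new_root_wf _ => G H GB HT.
apply: (moveB_label (w := w) (u := rt T) (e := true) GB HT) => //=.
- move=> x y xV yV; rewrite /adjT /= (nw xV) (nw yV) /=.
  case: (eqVneq x (rt T)) => [_|xr] /=; case: (eqVneq y (rt T)) => [_|yr] //=;
    by rewrite ?(eq_sym w) ?nw ?orbF.
- move=> x xV; rewrite /adjT /= eqxx (nw xV) /=.
  by case: (eqVneq x (rt T)) => [_|xr]; rewrite ?eqxx ?nw ?wf_parV.
- by rewrite eqxx expr1.
- by move=> x xV; rewrite nw // expr1.
Qed.

Lemma new_root_form x y : form new_root x y =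
  form T x y - (x w - x (rt T)) * (y w - y (rt T)).
Proof.
have ub : uniq (verts T) by case: wfT.
rewrite /form /= big_cons.
rewrite (eq_big_seq (fun v => term T x y v + (if v == rt T
   then - (x (rt T) * y (rt T)) + x (rt T) * y w + x w * y (rt T) else 0))).
  by rewrite big_split !sum_delta // /term /= !eqxx; ring.
move=> v vV; rewrite /term /= nw //; case: eqVneq => [->|vr].
  by rewrite rmorphB /= expr0; ring.
by rewrite addr0; ring.
Qed.
End NewRoot.

(** The form is nondegenerate and [c] is the diagonal entry of its inverse at
    the root. *)
Definition root_inverse T (c : rat) := forall x,
  {in verts T, forall v, v != rt T -> form T x (delta v) = 0} ->
  x (rt T) = c * form T x (delta (rt T)) /\
  (form T x (delta (rt T)) = 0 -> {in verts T, forall v, x v = 0}).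

(** In the coordinates x and x w - x (rt T) the new form is the old one minus a
    square, so its inverse at the functional x w is the old value at x (rt T)
    minus 1. *)
Lemma new_root_inverse T w c : wf T -> w \notin verts T -> root_inverse T c ->
  root_inverse (new_root T w) (c - 1).
Proof.
move=> wfT wN inv0 x ox; have rV : rt T \in verts T by case: wfT.
have nw u : u \in verts T -> (u == w) = false.
  by move=> uV; apply: contraNF wN => /eqP <-.
have dw : form T x (delta w) = 0.
  by apply: form0 => // u uV; rewrite /delta nw.
have [|xr x0] := inv0 x.
  move=> v vV vr; have := ox v; rewrite inE vV orbT /= nw // => /(_ isT isT).
  rewrite new_root_form // /delta (eq_sym w) nw // (eq_sym (rt T)) (negbTE vr).
  by rewrite subrr mulr0 subr0.
have := ox (rt T); rewrite inE rV orbT /= nw // => /(_ isT isT).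
have dE u v : delta u v = (v == u)%:R by [].
rewrite !new_root_form // dw !dE !eqxx (eq_sym w) nw //=.
set q := form T x _ in xr x0 *; move=> h.
have xw : x w - x (rt T) = - q by lra.
rewrite xw; split; first by lra.
move=> q0; have q0' : q = 0 by lra.
move=> v; rewrite inE => /orP[/eqP ->|]; last exact: x0.
by move: xw; rewrite xr q0' mulr0; lra.
Qed.

Definition plain_chain T := [/\ wf T, forall v, ~~ marked T v, forall v, todo T v &
  forall p c c', child T p c -> child T p c' -> c = c'].

Lemma new_root_chain T w : w \notin verts T -> plain_chain T ->
  plain_chain (new_root T w).
Proof.
move=> wN [wfT mT tT uT]; split=> //; first exact: new_root_wf.
have chE p c : child (new_root T w) p c ->
    p = w /\ c = rt T \/ p != w /\ child T p c.
  rewrite /child /= inE => /and3P[+ cw]; rewrite (negbTE cw) /= => cV.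
  case: (eqVneq c (rt T)) => [-> /eqP <-|cr cp]; first by left.
  right; rewrite cV cp; split=> //.
  by apply: contraNneq wN => <-; rewrite -(eqP cp); exact: wf_parV.
move=> p c c' /chE[[pE ->]|[pw h]] /chE[[pE' ->]|[pw' h']] //.
- by rewrite pE eqxx in pw'.
- by rewrite pE' eqxx in pw.
- exact: uT h h'.
Qed.

Lemma lower_root_inverse (n : nat) T c : plain_chain T -> root_inverse T c ->
  exists T', [/\ plain_chain T', tree_reach T T' & root_inverse T' (c - n%:R)].
Proof.
elim: n T c => [|n IH] T c cT rT.
  by exists T; split=> //; [apply: tree_reach_refl | rewrite subr0].
have [w wN] := fresh_label (verts T); have [wfT _ _ _] := cT.
have [T' [cT' r' rT']] := IH _ _ (new_root_chain wN cT) (new_root_inverse wfT wN rT).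
exists T'; split=> //; first exact: tree_reach_trans (new_root_reach wfT wN) r'.
by have -> : c - n.+1%:R = c - 1 - n%:R by rewrite -addn1 natrD; ring.
Qed.

Definition mark_root T := RTree (verts T) (rt T) (par T) (rk T) (wt T)
  (fun x => x == rt T) (todo T) (esgn T).

(** If [x] is orthogonal to all other vertices, its value under the form is
    [c] times the square of its pairing with the root. *)
Lemma mark_root_norm_state T c : plain_chain T -> root_inverse T c -> c < 0 ->
  norm_state (mark_root T).
Proof.
move=> [wfT mT tT uT] rT c0; split=> //=.
- by move=> p a b _; apply: uT.
- by move=> v _ _ _; rewrite tT orbT.
- by move=> v _ _; rewrite tT.
move=> x [u uV xu] ox; have [|xr x0] := rT x.
  by move=> v vV vr; apply: ox.
set q := form T x (delta (rt T)) in xr x0.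
have q0 : q != 0 by apply: contra_neq xu => /x0; apply.
have -> : form (mark_root T) x x = c * q ^+ 2.
  have -> : form (mark_root T) x x = form T x x by [].
  rewrite form_expand // (bigD1_seq (rt T)) /=; [|by case: wfT|by case: wfT].
  rewrite -/q xr big_seq_cond big1 ?addr0; first by ring.
  by move=> v /andP[vV vr]; rewrite [form _ _ _]ox ?mulr0.
by rewrite pmulr_llt0 // lt_neqAle eq_sym sqrf_eq0 q0 sqr_ge0.
Qed.

Lemma norm_state_of_branch G (v : vertex G) : weakly_negative_definite G ->
  (3 <= degree v)%N ->
  exists2 T, norm_state T & realize G T.
Proof.
move=> wG dv; have [d [dr dP]] := root_distance v.
pose M := [pred u : vertex G | (3 <= degree u)%N].
exists (rooted v d M); last exact: rooted_realize.
split.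
- exact: rooted_wf.
- by rewrite /= lift_funE.
- move=> p c c'; apply: (rooted_unary dP) => u; rewrite /M /= -ltnNge ltnS.
  by case: eqVneq => // ->; rewrite leqNgt dv.
- by move=> u _ _ _; rewrite orbT.
- by [].
- exact: rooted_wneg.
Qed.

Lemma norm_state_of_chain G : weakly_negative_definite G ->
  (forall v : vertex G, (degree v < 3)%N) ->
  exists T T', [/\ norm_state T', realize G T & tree_reach T T'].
Proof.
move=> [uF _] deg; have [r lr] := leaf_exists G.
have [d [dr dP]] := root_distance r.
pose T := rooted r d pred0.
have wfT : wf T := rooted_wf dP pred0.
have cT : plain_chain T.
  split=> //.
    move=> v; rewrite /= /lift_fun; case: insub => //.
  move=> p c c'; apply: (rooted_unary dP); last first.
    by rewrite /= /lift_fun; case: insub.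
  by move=> v _; case: eqVneq => [->//|_]; rewrite -ltnS.
pose c := invmx (framing_mxQ G) r r.
have rT : root_inverse T c.
  move=> x ox; rewrite (rooted_row dr dP).
  set z := \row_i x i; set q := (z *m _) 0 r.
  have zF : z *m framing_mxQ G = q *: delta_mx 0 r.
    apply/rowP=> i; rewrite [RHS]mxE [delta_mx _ _ _ _]mxE eqxx /=.
    case: (eqVneq i r) => [->|ir]; first by rewrite mulr1.
    rewrite mulr0 -(rooted_row dr dP pred0 x i) ox //.
    by apply/rooted_V; exists i.
  have zE : z = q *: (delta_mx 0 r *m invmx (framing_mxQ G)).
    by rewrite scalemxAl -zF mulmxK.
  split=> [|q0].
    have := congr1 (fun y : 'rV_ _ => y 0 r) zE.
    by rewrite -rowE !mxE => ->; rewrite mulrC.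
  by apply: (@rooted_row0 _ r d pred0 x); rewrite -/z zE q0 scale0r.
pose n := Num.bound `|c|.
have [T' [cT' r' rT']] := lower_root_inverse n cT rT.
exists T, (mark_root T'); split; last 1 first.
- move=> H /r'[K KT' HK]; exists K => //.
- apply: mark_root_norm_state cT' rT' _; rewrite subr_lt0.
  exact: le_lt_trans (ler_norm c) (archi_boundP (normr_ge0 c)).
- exact: rooted_realize.
Qed.

(** * Conclusion *)

Lemma reach_negative_definite G : weakly_negative_definite G ->
  exists2 G', negative_definite G' & reach G G'.
Proof.
move=> wG; have [T [T1 [iT1 GT r1]]] : exists T T', [/\ norm_state T', realize G T &
  tree_reach T T'].
  have [/existsP[v dv]|/existsPn deg] := boolP [exists v : vertex G, (3 <= degree v)%N].
    have [T iT GT] := norm_state_of_branch wG dv; exists T, T; split=> //;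
      exact: tree_reach_refl.
  by apply: norm_state_of_chain => // v; rewrite ltnNge.
have [T2 [iT2 r2 n2]] := reduce_all iT1.
have [H HT2 GH] := tree_reach_trans r1 r2 GT.
by exists H => //; apply: realize_negative_definite HT2.
Qed.

Local Close Scope ring_scope.

Theorem theorem1p1 (G : plumbing_tree) (hG : weakly_negative_definite G) :
  exists (G' : plumbing_tree) (N : nat) (T : nat -> plumbing_tree),
    [/\ negative_definite G', T 0 = G, T N = G' &
        forall i : nat, i < N -> neumann_move (T i) (T i.+1)].
Proof.
have [G' negG' [N [T [T0 TN moves]]]] := reach_negative_definite hG.
by exists G', N, T.
Qed.
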